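(* Assume $\frac{\alpha}{\mathsf p}+\frac{\gamma}{\mathsf q}=1$ and $\frac{\beta}{\mathsf p}+\frac{\delta}{\mathsf q}=1$, set $\rho_0=\alpha/\mathsf p$, $\rho_\ell=\delta/\mathsf q$, let $n\ge1$ and fix an initial state $(\eta,N)\in\{0,1\}^{\{1,\dots,\ell-1\}}\times\mathbb Z_{\ge0}$. Suppose $u:\mathbb R_+\times\{0,1,\dots,\ell+1\}^n\to\mathbb R$ satisfies: (1) for all $\vec x\in\{1,\dots,\ell\}^n$ and $t\in\mathbb R_+$, $\frac{d}{dt}u(t;\vec x)=\Delta^{\mathsf p,\mathsf q}u(t;\vec x)$; (2) for all $\vec x\in\{1,\dots,\ell-1\}^n$ such that $x_{i+1}=x_i+1$ for some $i\in\{1,\dots,n-1\}$, we have (for all $t\in\mathbb R_+$) $$\mathsf p\,u(t;\vec x_{i+1}^-)+\mathsf q\,u(t;\vec x_i^+)=(\mathsf p+\mathsf q)\,u(t;\vec x);$$ (3) for all $t\in\mathbb R_+$ and all integers $2\le x_2<\dots<x_n\le\ell$, $u(t;0,x_2,\dots,x_n)=(\rho_0q+1-\rho_0)\,u(t;1,x_2,\dots,x_n)$; (4) for all $t\in\mathbb R_+$ and all integers $1\le x_1<\dots<x_{n-1}\le\ell-1$, $u(t;x_1,\dots,x_{n-1},\ell+1)=(\rho_\ell/q+1-\rho_\ell)\,u(t;x_1,\dots,x_{n-1},\ell)$; (5) for any $\vec x\in\mathbb W^n_{[1,\ell]}$, $u(0;\vec x)=H(\eta,N;\vec x)$. Then for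 all $\vec x\in\mathbb W^n_{[1,\ell]}$ and $t\in\mathbb R_+$, $u(t;\vec x)=\mathbb E^{\eta,N}[H(\eta(t),N_\ell(t);\vec x)]$, where $\mathbb E^{\eta,N}$ denotes expectation with respect to open ASEP on the segment started from $(\eta,N)$.
   Context: Parameters: an integer $\ell\ge2$, real numbers $\mathsf p>\mathsf q>0$ and $\alpha,\beta,\gamma,\delta\ge0$; $q:=\mathsf q/\mathsf p\in(0,1)$. Open ASEP on a segment: the Markov process $(\eta(t),N_\ell(t))$ with $\eta(t)\in\{0,1\}^{\{1,\dots,\ell-1\}}$, $N_\ell(t)\in\mathbb Z$, with the following independent transitions: for $1\le x\le\ell-2$ a particle jumps from $x$ to $x+1$ at rate $\mathsf p\,\eta_x(1-\eta_{x+1})$ and from $x+1$ to $x$ at rate $\mathsf q\,\eta_{x+1}(1-\eta_x)$; a particle is created (resp. annihilated) at site $1$ at rate $\alpha(1-\eta_1)$ (resp. $\gamma\eta_1$); a particle is created at site $\ell-1$ at rate $\delta(1-\eta_{\ell-1})$, in which case $N_\ell$ decreases by $1$, and annihilated at site $\ell-1$ at rate $\beta\eta_{\ell-1}$, in which case $N_\ell$ increases by $1$. For $1\le x\le\ell$: $N_x(\eta,N_\ell)=\sum_{i=x}^{\ell-1}\eta_i+N_\ell$, $Q_x(\eta,N_\ell)=q^{N_x(\eta,N_\ell)}$, and $H(\eta,N_\ell;\vec x)=\prod_{i=1}^nQ_{x_i}(\eta,N_\ell)$. $\mathbb W^n_{[1,\ell]}=\{\vec x\in\mathbb Z^n:1\le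 x_1<\dots<x_n\le\ell\}$, $\vec x_i^\pm=(x_1,\dots,x_i\pm1,\dots,x_n)$, and $$\Delta^{\mathsf p,\mathsf q}f(\vec x)=\sum_{i=1}^n\big(\mathsf p f(\vec x_i^-)+\mathsf q f(\vec x_i^+)-(\mathsf p+\mathsf q)f(\vec x)\big).$$
   Formalization: Condition (2) is assumed for all x in {1,…,ℓ}^n with x_{i+1}=x_i+1, rather than only for x in {1,…,ℓ−1}^n; as literally stated the claim fails, e.g. for ℓ=n=2, where (2) would be vacuous and u(t;1,2) would be arbitrary. *)

(* Defs.v *)
From HB Require Import structures.
From mathcomp Require Import all_boot all_order all_algebra.
From mathcomp Require Import all_classical all_reals all_analysis.
Set Implicit Arguments.
Unset Strict Implicit.
Unset Printing Implicit Defensive.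
Import Order.TTheory GRing.Theory Num.Theory.
Import numFieldNormedType.Exports.
Local Open Scope classical_set_scope.
Local Open Scope ring_scope.

(* {0,1}^{1,...,l-1} x Z.  The ordinal k : 'I_l.-1 stands for the site k+1. *)
Definition config (l : nat) : choiceType := {ffun 'I_l.-1 -> bool}.
Definition asep_state (l : nat) : choiceType := (config l * int)%type.

Definition set_occ (l : nat) (eta : config l) (k : 'I_l.-1) (b : bool) :
  config l := [ffun j => if j == k then b else eta j].

(* First sum: bulk jumps, with j the site to the right of i.  Second sum: left
   reservoir, at site 1.  Third sum: right reservoir, at site l-1, whose
   transitions also update the second component N_l of the state. *)
Definition asep_generator (R : realType) (l : nat)
    (pp qq alpha beta gamma delta : R) (f : asep_state l -> R)
    (s : asep_state l) : R :=
  let eta := s.1 in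
  let N := s.2 in
  let transition (rate : R) (s' : asep_state l) := rate * (f s' - f s) in
  \sum_(i : 'I_l.-1) \sum_(j : 'I_l.-1 | j == i.+1 :> nat)
    (transition (pp * (eta i && ~~ eta j)%:R)
                (set_occ (set_occ eta i false) j true, N)
     + transition (qq * (eta j && ~~ eta i)%:R)
                  (set_occ (set_occ eta j false) i true, N))
  + \sum_(i : 'I_l.-1 | i == 0%N :> nat)
    (transition (alpha * (~~ eta i)%:R) (set_occ eta i true, N)
     + transition (gamma * (eta i)%:R) (set_occ eta i false, N))
  + \sum_(i : 'I_l.-1 | i.+1 == l.-1 :> nat)
    (transition (delta * (~~ eta i)%:R) (set_occ eta i true, N - 1)
     + transition (beta * (eta i)%:R) (set_occ eta i false, N + 1)).

Record transition_function (R : realType) (S : choiceType)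
    (tp : R -> S -> S -> R) : Prop := {
  transition_ge0 : forall t x y, 0 <= t -> 0 <= tp t x y ;
  transition_sum1 : forall t x, 0 <= t ->
    (\esum_(y in [set: S]) (tp t x y)%:E = 1)%E ;
  transition_at0 : forall x y, tp 0 x y = (x == y)%:R ;
  transition_CK : forall s t x z, 0 <= s -> 0 <= t ->
    ((tp (s + t) x z)%:E
     = \esum_(y in [set: S]) (tp s x y * tp t y z)%:E)%E
}.

(* The Q-matrix of tp is the matrix of the operator L, whose (x, y) entry is
   the value at x of L applied to the indicator function of y. *)
Definition has_generator (R : realType) (S : choiceType)
    (tp : R -> S -> S -> R) (L : (S -> R) -> S -> R) : Prop :=
  forall x y, (tp h x y - (x == y)%:R) / h @[h --> 0^'+]
              --> L (fun z => (z == y)%:R) x.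

(* Markov property with respect to the natural filtration, for a process
   indexed by [0, +oo) (its values at negative times play no role) with values
   in a countable state space: [past] is a finite list of pairs (time, state)
   with times in [0, s]. *)
Definition markov_process (R : realType) (d : measure_display)
    (Omega : measurableType d) (P : probability Omega R) (S : choiceType)
    (X : R -> Omega -> S) (tp : R -> S -> S -> R) (x0 : S) : Prop :=
  [/\ forall t x, 0 <= t -> measurable (X t @^-1` [set x]),
      P (X 0 @^-1` [set x0]) = 1%E
    & forall (past : seq (R * S)) (s t : R) (x y : S), 0 <= s -> 0 <= t ->
        (forall r, r \in past -> 0 <= r.1 <= s) ->
        let A := [set w | (forall r, r \in past -> X r.1 w = r.2)
                          /\ X s w = x] in
        P (A `&` X (s + t) @^-1` [set y]) = (P A * (tp t x y)%:E)%E].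

(* X t is the pair (eta(t), N_l(t)). *)
Definition open_asep (R : realType) (l : nat)
    (pp qq alpha beta gamma delta : R) (d : measure_display)
    (Omega : measurableType d) (P : probability Omega R)
    (X : R -> Omega -> asep_state l) (s0 : asep_state l) : Prop :=
  exists tp : R -> asep_state l -> asep_state l -> R,
    [/\ transition_function tp,
        has_generator tp (asep_generator pp qq alpha beta gamma delta)
      & markov_process P X tp s0].

Definition height (l : nat) (s : asep_state l) (x : int) : int :=
  \sum_(k : 'I_l.-1 | x <= k.+1%:Z) (s.1 k : nat)%:Z + s.2.

Definition duality_Q (R : realType) (l : nat) (q : R) (s : asep_state l)
  (x : int) : R := q ^ height s x.

Definition duality_H (R : realType) (l n : nat) (q : R) (s : asep_state l)
  (x : {ffun 'I_n -> int}) : R := \prod_(i < n) duality_Q q s (x i).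

Definition in_box (n : nat) (a b : int) (x : {ffun 'I_n -> int}) : Prop :=
  forall i, a <= x i <= b.

Definition weyl_chamber (n l : nat) (x : {ffun 'I_n -> int}) : Prop :=
  in_box 1 l%:Z x /\ (forall i j : 'I_n, (i < j)%N -> x i < x j).

(* shift_coord x i 1 and shift_coord x i (-1) are the vectors x_i^+ and x_i^-. *)
Definition shift_coord (n : nat) (x : {ffun 'I_n -> int}) (i : 'I_n) (e : int) :
  {ffun 'I_n -> int} := [ffun k => if k == i then x k + e else x k].

Definition Delta (R : realType) (n : nat) (pp qq : R)
    (f : {ffun 'I_n -> int} -> R) (x : {ffun 'I_n -> int}) : R :=
  \sum_(i < n) (pp * f (shift_coord x i (-1)) + qq * f (shift_coord x i 1)
                - (pp + qq) * f x).

(* Derivative of a function of t in [0, +oo): one-sided at t = 0, two-sided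
   at t > 0. *)
Definition has_derivative_Rplus (R : realType) (f : R -> R) (t v : R) : Prop :=
  (f (t + h) - f t) / h @[h --> within [set h | 0 <= t + h] 0^'] --> v.

(* Main.v *)
Require Import Defs.
From HB Require Import structures.
From mathcomp Require Import all_boot all_order all_algebra.
From mathcomp Require Import all_classical all_reals all_analysis.
From mathcomp Require Import ring lra zify.
Import Order.TTheory GRing.Theory Num.Theory.
Import numFieldNormedType.Exports.
Local Open Scope classical_set_scope.
Local Open Scope ring_scope.
Set Implicit Arguments.
Unset Strict Implicit.
Unset Printing Implicit Defensive.

(** Both u and t |-> E H(X_t; .) solve the same linear system on the finite Weyl
    chamber. Extending Q to the sites 0 and l + 1 by the two boundary rules, the
    transitions across one bond change a single Q_x, which gives L Q_x =
    p Q_(x-1) + q Q_(x+1) - (p + q) Q_x and hence L H = Delta H for the extended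
    product H; the extended H satisfies the same boundary relations as u, and
    these turn Delta into one matrix A acting on functions on the chamber.

    H is unbounded in N, so the passage from L H = A H to
    E H(X_t) = exp(tA) H(X_0) goes through positivity. If G = L + lam is a
    positive operator, then exp(lam t) tp t = I + (superadditive in t), so
    exp(lam t) tp t >= I + tG entrywise for every t, and Chapman-Kolmogorov gives
    exp(lam t) tp t >= (I + tG/m)^m. Since L 1 = 0, the right-hand side times
    exp(-lam t) has total mass exp(-lam t) (1 + lam t/m)^m -> 1: no mass is lost
    in the limit, so it converges to tp t, and its action on H is the Euler
    scheme of the finite system. *)

(** * Calculus with derivatives on the half-line *)

Lemma has_derivative_Rplus_lipschitz (R : realType) (f : R -> R) (t v : R) :
  has_derivative_Rplus f t v ->
  \forall h \near (0 : R), 0 <= t + h -> `|f (t + h) - f t| <= (`|v| + 1) * `|h|.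
Proof.
move=> /cvgrPdist_le /(_ 1 ltr01); rewrite near_withinE near_withinE => H.
near=> h => th.
have [->|h0] := eqVneq h 0; first by rewrite addr0 subrr normr0 mulr0.
have /(_ h0 th) H1 : h != 0 -> 0 <= t + h -> `|v - (f (t + h) - f t) / h| <= 1.
  by near: h.
have le1 : `|(f (t + h) - f t) / h| <= `|v| + 1.
  have -> : (f (t + h) - f t) / h = v - (v - (f (t + h) - f t) / h) by ring.
  by rewrite (le_trans (ler_normB _ _))// lerD2l.
have := ler_pM (normr_ge0 _) (normr_ge0 _) le1 (lexx `|h|).
by rewrite -normrM divfK.
Unshelve. all: by end_near. Qed.

Lemma has_derivative_Rplus_within (R : realType) (f df : R -> R) (a b : R) :
  0 <= a ->
  (forall t, a <= t <= b -> has_derivative_Rplus f t (df t)) ->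
  {within `[a, b], continuous f}.
Proof.
move=> a0 H; apply/subspace_continuousP => t /= /[!in_itv] /= tab.
apply/cvgrPdist_le => e e0.
have /nbhs_ballP[r r0 Hr] := has_derivative_Rplus_lipschitz (H _ tab).
set K := `|df t| + 1 in Hr; have K0 : 0 < K by rewrite ltr_wpDl.
rewrite near_withinE; near=> s => /= /[!in_itv] /= /andP[sa sb].
have ts : `|t - s| < r by near: s; apply: cvgr_dist_lt.
have tse : `|t - s| < e / K.
  by near: s; apply: cvgr_dist_lt => //; rewrite divr_gt0.
have := Hr (s - t); rewrite /ball /= sub0r normrN distrC => /(_ ts).
rewrite [t + _]addrC subrK => /(_ (le_trans a0 sa)) => Hs.
rewrite distrC (le_trans Hs)// mulrC -ler_pdivlMr// ltW.
Unshelve. all: by end_near. Qed.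

Lemma has_derivative_Rplus_is_derive (R : realType) (f : R -> R) (t v : R) :
  0 < t -> has_derivative_Rplus f t v -> is_derive t (1 : R) f v.
Proof.
move=> t0 H.
have H' : (fun h => h^-1 *: ((f \o shift t) (h *: (1 : R)) - f t)) @ 0^' --> v.
  apply/cvgrPdist_le => e e0; move/cvgrPdist_le: H => /(_ e e0).
  rewrite !near_withinE => H.
  near=> h => h0.
  have th : 0 <= t + h.
    have : `|0 - h| < t by near: h; apply: nbhsx_ballx.
    by rewrite sub0r normrN ltr_norml => /andP[]; lra.
  have H1 : h != 0 -> 0 <= t + h -> `|v - (f (t + h) - f t) / h| <= e by near: h.
  by rewrite /= /GRing.scale /= mulr1 [h + t]addrC [_^-1 * _]mulrC H1.
apply: DeriveDef; first by apply/cvg_ex; exists v.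
exact/cvg_lim.
Unshelve. all: by end_near. Qed.

(** The mean value theorem asks for a two-sided derivative only inside the interval, where t > a >=
    0; at the end points continuity is enough, and [has_derivative_Rplus] provides it. *)
Lemma mean_value_Rplus (R : realType) (f df : R -> R) (a b K : R) :
  0 <= a -> a <= b ->
  (forall t, a <= t <= b -> has_derivative_Rplus f t (df t)) ->
  (forall t, a <= t <= b -> `|df t| <= K) ->
  `|f b - f a| <= K * (b - a).
Proof.
move=> a0; rewrite le_eqVlt => /predU1P[-> _ _|ab fdf dfK].
  by rewrite !subrr normr0 mulr0.
have [|c] := @MVT _ f df _ _ ab _ (has_derivative_Rplus_within a0 fdf).
  move=> x; rewrite in_itv /= => /andP[ax xb].
  apply: has_derivative_Rplus_is_derive; first exact: le_lt_trans a0 ax.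
  by apply: fdf; rewrite !ltW.
rewrite in_itv /= => /andP[ac cb] ->.
rewrite normrM [`|b - a|]ger0_norm ?subr_ge0 ?(ltW ab) //.
rewrite ler_pM2r ?subr_gt0 //.
by apply: dfK; rewrite !ltW.
Qed.

Lemma has_derivative_Rplus_subM (R : realType) (f : R -> R) (t v c : R) :
  has_derivative_Rplus f t v ->
  has_derivative_Rplus (fun s => f s - s * c) t (v - c).
Proof.
move=> /cvgrPdist_le H; apply/cvgrPdist_le => e e0; move: (H e e0).
rewrite !near_withinE; apply: filterS => h He h0 th.
suff -> : (f (t + h) - (t + h) * c - (f t - t * c)) / h = (f (t + h) - f t) / h - c.
  have -> : v - c - ((f (t + h) - f t) / h - c) = v - (f (t + h) - f t) / h
    by ring.
  exact: He.
by move: h0 => /= h0; field.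
Qed.

(** * Euler scheme for a finite linear system *)

Section euler_scheme.
Context {R : realType} {I : finType}.
Implicit Types (M : I -> I -> R) (w : I -> R).

Definition matrix_act M w : I -> R := fun i => \sum_j M i j * w j.

Definition euler_step M (h : R) w : I -> R := fun i => w i + h * matrix_act M w i.

Definition norm1 w : R := \sum_i `|w i|.

(** An upper bound for the operator norm attached to [norm1], not that norm itself; convergence does
    not require a sharp constant. *)
Definition matrix_norm1 M : R := \sum_i \sum_j `|M i j|.

Lemma norm1_ge0 w : 0 <= norm1 w.
Proof. exact: sumr_ge0. Qed.

Lemma matrix_norm1_ge0 M : 0 <= matrix_norm1 M.
Proof. by apply: sumr_ge0 => i _; exact: sumr_ge0. Qed.

Lemma ler_norm1 w i : `|w i| <= norm1 w.
Proof. by rewrite /norm1 (bigD1 i)//= lerDl sumr_ge0. Qed.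

Lemma norm1_triangle w1 w2 w3 :
  norm1 (fun i => w1 i - w3 i) <=
  norm1 (fun i => w1 i - w2 i) + norm1 (fun i => w2 i - w3 i).
Proof.
rewrite -big_split /=; apply: ler_sum => i _.
by rewrite (le_trans _ (ler_normD _ _))// addrA subrK.
Qed.

Lemma ler_matrix_act M w i :
  `|matrix_act M w i| <= (\sum_j `|M i j|) * norm1 w.
Proof.
rewrite (le_trans (ler_norm_sum _ _ _))// mulr_suml; apply: ler_sum => j _.
by rewrite normrM ler_wpM2l// ler_norm1.
Qed.

Lemma norm1_matrix_act M w :
  norm1 (matrix_act M w) <= matrix_norm1 M * norm1 w.
Proof. by rewrite mulr_suml; apply: ler_sum => i _; exact: ler_matrix_act. Qed.

Lemma matrix_actB M w1 w2 i :
  matrix_act M (fun j => w1 j - w2 j) i = matrix_act M w1 i - matrix_act M w2 i.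
Proof. by rewrite /matrix_act -sumrB; apply: eq_bigr => j _; rewrite mulrBr. Qed.

Lemma euler_stepB M h w1 w2 : 0 <= h ->
  norm1 (fun i => euler_step M h w1 i - euler_step M h w2 i) <=
  (1 + h * matrix_norm1 M) * norm1 (fun i => w1 i - w2 i).
Proof.
move=> h0; rewrite mulrDl mul1r -mulrA.
apply: le_trans (lerD (lexx _) (ler_wpM2l h0 (norm1_matrix_act _ _))).
rewrite /norm1 mulr_sumr -big_split /=; apply: ler_sum => i _.
rewrite -[h in leRHS]ger0_norm// -normrM (le_trans _ (ler_normD _ _))//.
rewrite matrix_actB /euler_step le_eqVlt.
by apply/orP; left; apply/eqP; congr (`|_|); ring.
Qed.

Variables (M : I -> I -> R) (v : R -> I -> R).
Hypothesis ode : forall t i, 0 <= t ->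
  has_derivative_Rplus (v ^~ i) t (matrix_act M (v t) i).

Lemma ode_bounded t : exists B, forall s, 0 <= s <= t -> norm1 (v s) <= B.
Proof.
have bnd i : exists B, forall s, 0 <= s <= t -> `|v s i| <= B.
  have vc : {within `[0, t], continuous (v ^~ i)}.
    by apply: (has_derivative_Rplus_within (lexx 0)) => s /andP[s0 _]; exact: ode.
  have /compact_bounded[B [_ HB]] := continuous_compact vc (@segment_compact _ _ _).
  (* [compact_bounded] bounds the image by every number above [B]; [B + 1] is one of them. *)
  exists (B + 1) => s st; apply: HB; first by rewrite ltrDl.
  by exists s => //=; rewrite in_itv.
have [B HB] := choice bnd.
by exists (\sum_i B i) => s st; apply: ler_sum => i _; exact: HB.
Qed.

Let C := matrix_norm1 M.

(** The mean value inequality is used twice. It bounds the drift of [v] from [v a] by C B (b - a),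
    hence the derivative of [v] minus its tangent at [a] by C times that; integrating once more
    gives the second factor b - a. *)
Lemma euler_local_error B a b : 0 <= a -> a <= b ->
  (forall s, a <= s <= b -> norm1 (v s) <= B) ->
  norm1 (fun i => v b i - euler_step M (b - a) (v a) i) <= C ^+ 2 * B * (b - a) ^+ 2.
Proof.
move=> a0 ab vB; have C0 : 0 <= C := matrix_norm1_ge0 M.
have ba0 : 0 <= b - a by rewrite subr_ge0.
have row0 i : 0 <= \sum_j `|M i j| by exact: sumr_ge0.
have lip s : a <= s <= b -> norm1 (fun i => v s i - v a i) <= C * B * (b - a).
  move=> /andP[as_ sb]; rewrite /C /matrix_norm1 -mulrA mulr_suml.
  apply: ler_sum => i _.
  have H : `|v s i - v a i| <= (\sum_j `|M i j|) * B * (s - a).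
    apply: (@mean_value_Rplus _ (v ^~ i) (fun r => matrix_act M (v r) i)) => //.
      by move=> r /andP[ar _]; apply: ode; exact: le_trans ar.
    move=> r /andP[ar rs]; rewrite (le_trans (ler_matrix_act _ _ _))//.
    by rewrite ler_wpM2l// vB// ar (le_trans rs).
  rewrite (le_trans H)// -mulrA ler_wpM2l// ler_wpM2l ?lerB//.
  by rewrite (le_trans (norm1_ge0 _) (vB s _))// as_.
have -> : C ^+ 2 * B * (b - a) ^+ 2 = C * (C * B * (b - a) * (b - a)) by ring.
rewrite {1}/C /matrix_norm1 mulr_suml; apply: ler_sum => i _.
set c := matrix_act M (v a) i.
have -> : v b i - euler_step M (b - a) (v a) i = v b i - b * c - (v a i - a * c).
  by rewrite /euler_step -/c; ring.
rewrite mulrA.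
apply: (@mean_value_Rplus _ (fun r => v r i - r * c)
          (fun r => matrix_act M (v r) i - c)) => // r /andP[ar rb].
  by apply: has_derivative_Rplus_subM; apply: ode; exact: le_trans ar.
rewrite -matrix_actB (le_trans (ler_matrix_act _ _ _))//.
by rewrite ler_wpM2l// lip// ar.
Qed.

(** Discrete Gronwall argument: each step adds one local error and multiplies the earlier ones by at
    most 1 + h C <= exp(h C). *)
Lemma euler_global_error B t m k : (0 < m)%N -> (k <= m)%N -> 0 <= t ->
  (forall s, 0 <= s <= t -> norm1 (v s) <= B) ->
  norm1 (fun i => v (t / m%:R * k%:R) i - iter k (euler_step M (t / m%:R)) (v 0) i)
  <= k%:R * (expR (t / m%:R * C) ^+ k * (C ^+ 2 * B * (t / m%:R) ^+ 2)).
Proof.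
move=> m0 km t0 vB; set h := t / m%:R.
have h0 : 0 <= h by rewrite divr_ge0.
have C0 : 0 <= C := matrix_norm1_ge0 M.
have B0 : 0 <= B by rewrite (le_trans (norm1_ge0 _) (vB 0 _))// lexx.
set e := expR _; have e1 : 1 <= e by rewrite -expR0 ler_expR mulr_ge0.
have e0 : 0 <= e by exact: expR_ge0.
set D := C ^+ 2 * B * h ^+ 2.
have D0 : 0 <= D by rewrite !mulr_ge0// exprn_ge0.
elim: k km => [_|k IH km].
  by rewrite mulr0 mul0r /norm1 big1// => i _; rewrite subrr normr0.
apply: (le_trans (norm1_triangle _ (euler_step M h (v (h * k%:R))) _)).
have -> : k.+1%:R * (e ^+ k.+1 * D) = e ^+ k.+1 * D + e * (k%:R * (e ^+ k * D)).
  by rewrite -natr1 exprS; ring.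
apply: lerD.
  have hk : h * k.+1%:R - h * k%:R = h by rewrite -natr1; ring.
  rewrite -{2}hk (le_trans (@euler_local_error B _ _ _ _ _)) ?mulr_ge0//.
  - by rewrite ler_wpM2l// ler_nat.
  - move=> s /andP[ks sk]; apply: vB; rewrite (le_trans _ ks) ?mulr_ge0//=.
    rewrite (le_trans sk)// /h -mulrA mulrC -[leRHS]mul1r; apply: ler_wpM2r => //.
    by rewrite mulrC ler_pdivrMr ?ltr0n// mul1r ler_nat.
  - by rewrite hk -/D ler_peMl// exprn_ege1.
rewrite iterS (le_trans (euler_stepB _ _ _ _))// ler_pM ?norm1_ge0 ?IH ?(ltnW km)//.
  by rewrite addr_ge0// mulr_ge0.
exact: expR_ge1Dx.
Qed.

Lemma euler_cvg t i : 0 <= t ->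
  iter m (euler_step M (t / m%:R)) (v 0) i @[m --> \oo] --> v t i.
Proof.
move=> t0; have [B vB] := ode_bounded t.
(* After m steps the global bound is m exp(t C) C^2 B (t/m)^2 = K/m. *)
set K := expR (t * C) * (C ^+ 2 * B * t ^+ 2).
have Km : K * m%:R^-1 @[m --> \oo] --> 0.
  rewrite -[0](mulr0 K); apply: cvgMl_tmp.
  rewrite -[X in X @ _ --> _]/((fun n => n%:R^-1)) -(cvg_shiftS _).
  exact: cvg_harmonic.
apply/cvgrPdist_le => e e0; move/cvgrPdist_le: Km => /(_ e e0) Km.
near=> m.
have m0 : (0 < m)%N by near: m; exists 1%N.
have := euler_global_error m0 (leqnn m) t0 vB.
have mR : m%:R != 0 :> R by rewrite pnatr_eq0 -lt0n.
rewrite divfK// => H; rewrite (le_trans (ler_norm1 _ i) (le_trans H _))//.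
rewrite -expRM_natl.
have -> : m%:R * (t / m%:R * C) = t * C by field.
have -> : m%:R * (expR (t * C) * (C ^+ 2 * B * (t / m%:R) ^+ 2)) = K / m%:R.
  by rewrite /K; field.
rewrite (le_trans (ler_norm _))// -normrN -[- _]add0r.
by near: m.
Unshelve. all: by end_near. Qed.

End euler_scheme.

(** * Multiplication by an exponential *)

Lemma is_derive_has_derivative_Rplus (R : realType) (f : R -> R) (t v : R) :
  is_derive t (1 : R) f v -> has_derivative_Rplus f t v.
Proof.
move=> [/cvg_ex[/= l fl] <-]; have -> : 'D_1 f t = l by exact/cvg_lim.
move/cvgrPdist_le: fl => H; apply/cvgrPdist_le => e e0; move: (H e e0).
rewrite !near_withinE; apply: filterS => h He /= /He + _.
by rewrite /= /GRing.scale /= mulr1 [h + t]addrC [_^-1 * _]mulrC.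
Qed.

Lemma has_derivative_RplusM (R : realType) (f g : R -> R) (t df dg : R) :
  {for t, continuous f} ->
  has_derivative_Rplus f t df -> has_derivative_Rplus g t dg ->
  has_derivative_Rplus (fun s => f s * g s) t (df * g t + f t * dg).
Proof.
rewrite /has_derivative_Rplus => fc Hf Hg.
have fc' : f (t + h) @[h --> within [set h | 0 <= t + h] 0^'] --> f t.
  apply: cvg_trans (_ : f (t + h) @[h --> (0 : R)] --> _).
    by apply: cvg_app; apply: cvg_trans (cvg_within _) (cvg_within _).
  have th : t + h @[h --> (0 : R)] --> t.
    have H : t + h @[h --> (0 : R)] --> t + 0 by apply: cvgD; [exact: cvg_cst|exact: cvg_id].
    by rewrite addr0 in H.
  exact: (cvg_comp _ _ th fc).
have gc : g t @[h --> within [set h | 0 <= t + h] 0^'] --> g t by exact: cvg_cst.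
have H := cvgD (cvgM Hf gc) (cvgM fc' Hg).
suff -> : (fun h => (f (t + h) * g (t + h) - f t * g t) / h) =
  (fun h => (f (t + h) - f t) / h * g t + f (t + h) * ((g (t + h) - g t) / h)) by exact: H.
by apply/funext => h; ring.
Qed.

Lemma is_derive_expRM (R : realType) (c t : R) :
  is_derive t (1 : R) (fun s => expR (c * s)) (c * expR (c * t)).
Proof.
have H : is_derive t (1 : R) (fun s => c * s) c.
  by apply: is_derive_eq; rewrite /GRing.scale /= mulr1.
rewrite mulrC.
exact: (is_derive1_comp (is_derive_expR (c * t)) H).
Qed.

(** The integrating factor: it turns a solution of u' = A u into a solution for the matrix A + c
    I. *)
Lemma has_derivative_Rplus_expRM (R : realType) (c t v : R) (u : R -> R) :
  has_derivative_Rplus u t v ->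
  has_derivative_Rplus (fun s => expR (c * s) * u s) t
    (expR (c * t) * (v + c * u t)).
Proof.
have -> : expR (c * t) * (v + c * u t) = c * expR (c * t) * u t + expR (c * t) * v.
  by ring.
have e := is_derive_expRM c t.
apply: has_derivative_RplusM; last exact: is_derive_has_derivative_Rplus.
by apply: differentiable_continuous; apply/derivable1_diffP.
Qed.

(** This is [euler_cvg] for a 1 by 1 matrix; it later gives the limit of the total mass of the
    iterates. *)
Lemma expR_euler_cvg (R : realType) (t c : R) : 0 <= t ->
  (1 + t / m%:R * c) ^+ m @[m --> \oo] --> expR (c * t).
Proof.
move=> t0; pose M (_ _ : 'I_1) : R := c; pose v (s : R) (_ : 'I_1) := expR (c * s).
have ode s i : 0 <= s -> has_derivative_Rplus (v ^~ i) s (matrix_act M (v s) i).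
  move=> _; rewrite /matrix_act big_ord1.
  exact/is_derive_has_derivative_Rplus/is_derive_expRM.
have iterE h k : iter k (euler_step M h) (v 0) ord0 = (1 + h * c) ^+ k.
  elim: k => [|k IH]; first by rewrite /= /v mulr0 expR0 expr0.
  by rewrite iterS /euler_step /matrix_act big_ord1 IH exprS /M; ring.
have := euler_cvg (i := ord0) ode t0.
by under [X in X @ _ --> _]funext do rewrite iterE.
Qed.

(** * Positive functionals with finitely many atoms *)

Section positive_functional.
Context {R : realType} {S : choiceType}.
Implicit Types (f g : S -> R) (Phi : (S -> R) -> R).

(** The weights form a list in which a state may occur several times, so that a sum of functionals
    is a concatenation of lists. *)
Definition positive_functional Phi : Prop :=
  exists2 w : seq (R * S), all (fun a => 0 <= a.1) w &
    forall f, Phi f = \sum_(a <- w) a.1 * f a.2.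

Definition indic_pt (y : S) : S -> R := fun z => (z == y)%:R.

Lemma positive_functional_eval x : positive_functional (fun f => f x).
Proof. by exists [:: (1, x)] => [|f]; rewrite /= ?ler01// big_seq1 mul1r. Qed.

Lemma positive_functionalD Phi Psi :
  positive_functional Phi -> positive_functional Psi ->
  positive_functional (fun f => Phi f + Psi f).
Proof.
move=> [w w0 Phiw] [w' w0' Psiw]; exists (w ++ w'); first by rewrite all_cat w0.
by move=> f; rewrite big_cat Phiw Psiw.
Qed.

Lemma positive_functionalZ c Phi : 0 <= c ->
  positive_functional Phi -> positive_functional (fun f => c * Phi f).
Proof.
move=> c0 [w w0 Phiw]; exists [seq (c * a.1, a.2) | a <- w].
  by rewrite all_map; apply: sub_all w0 => a /= ?; rewrite mulr_ge0.
move=> f; rewrite Phiw mulr_sumr big_map; apply: eq_bigr => a _ /=.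
by rewrite mulrA.
Qed.

Lemma positive_functional_sum (J : Type) (r : seq J) (P : pred J)
    (Phi : J -> (S -> R) -> R) :
  (forall j, P j -> positive_functional (Phi j)) ->
  positive_functional (fun f => \sum_(j <- r | P j) Phi j f).
Proof.
move=> H; elim: r => [|j r IH].
  by exists [::] => // f; rewrite !big_nil.
case: (boolP (P j)) => Pj.
  have [w w0 Hw] := positive_functionalD (H j Pj) IH.
  by exists w => // f; rewrite big_cons Pj Hw.
by case: IH => w w0 Hw; exists w => // f; rewrite big_cons (negbTE Pj) Hw.
Qed.

(** Applied to a positive operator with finite rows, this shows that its iterates have finite rows
    too. *)
Lemma positive_functional_comp Phi (Psi : S -> (S -> R) -> R) :
  positive_functional Phi -> (forall y, positive_functional (Psi y)) ->
  positive_functional (fun f => Phi (Psi^~ f)).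
Proof.
move=> [w + Phiw] HPsi.
have -> : (fun f => Phi (Psi^~ f)) = fun f => \sum_(a <- w) a.1 * Psi a.2 f.
  by apply/funext => f; rewrite Phiw.
elim: w {Phiw} => [_|a w IH /= /andP[a0 w0]].
  by exists [::] => // f; rewrite !big_nil.
have [w' w0' H] := positive_functionalD (positive_functionalZ a0 (HPsi a.2)) (IH w0).
by exists w' => // f; rewrite big_cons H.
Qed.

Lemma positive_functional_ge0 Phi f :
  positive_functional Phi -> (forall y, 0 <= f y) -> 0 <= Phi f.
Proof.
move=> [w /allP w0 ->] f0; rewrite big_seq; apply: sumr_ge0 => a /w0 a0.
by rewrite mulr_ge0.
Qed.

Lemma positive_functionalDZ Phi f g c : positive_functional Phi ->
  Phi (fun y => f y + c * g y) = Phi f + c * Phi g.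
Proof.
move=> [w _ H]; rewrite !H mulr_sumr -big_split /=.
by apply: eq_bigr => a _; ring.
Qed.

Lemma positive_functional_linear Phi (J : finType) (c : J -> R) (g : J -> S -> R) :
  positive_functional Phi ->
  Phi (fun y => \sum_j c j * g j y) = \sum_j c j * Phi (g j).
Proof.
move=> [w _ H]; rewrite H; under [RHS]eq_bigr do rewrite H mulr_sumr.
rewrite exchange_big /=; apply: eq_bigr => a _; rewrite mulr_sumr.
by apply: eq_bigr => j _; ring.
Qed.

(** The values at indicators are the matrix entries of the functional. They vanish off the atoms, so
    any larger list [F'] serves as well, and a list can be enlarged to contain prescribed states. *)
Lemma positive_functional_support Phi : positive_functional Phi ->
  exists F : seq S, forall F', uniq F' -> {subset F <= F'} ->
    forall f, Phi f = \sum_(y <- F') f y * Phi (indic_pt y).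
Proof.
move=> [w _ H]; exists (unzip2 w) => F' uF' wF' f; rewrite H.
under [RHS]eq_bigr do rewrite H mulr_sumr.
rewrite exchange_big /= big_seq [RHS]big_seq; apply: eq_bigr => a aw.
have aF : a.2 \in F' by apply: wF'; exact: map_f.
rewrite (bigD1_seq a.2)//= big1 => [|y ya].
  by rewrite /indic_pt eqxx addr0 /= mulr1 mulrC.
by rewrite /indic_pt eq_sym (negbTE ya) !mulr0.
Qed.

End positive_functional.

(** * Transition functions whose generator is positive after adding a multiple of the identity *)

Lemma esum_ge_seq {R : realType} {S : choiceType} (a : S -> R) (F : seq S) :
  uniq F -> ((\sum_(y <- F) a y)%:E <= \esum_(y in [set: S]) (a y)%:E)%E.
Proof.
move=> uF; apply: esum_ge; exists [set` F].
  by split => //; exact: finite_seq.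
by rewrite -fsbig_seq// sumEFin.
Qed.

Lemma esum_le_seq {R : realType} {S : choiceType} (a : S -> R) (M : R) :
  (forall F : seq S, uniq F -> \sum_(y <- F) a y <= M) ->
  (\esum_(y in [set: S]) (a y)%:E <= M%:E)%E.
Proof.
move=> H; apply: ge_ereal_sup => _ [X [fX _] <-].
rewrite fsbig_finite//= sumEFin lee_fin; apply: H.
exact: finmap.fset_uniq.
Qed.

Section transition.
Context {R : realType} {S : choiceType} (tp : R -> S -> S -> R).
Hypothesis htp : transition_function tp.

Lemma transition_CK_ge (F : seq S) s t x z : uniq F -> 0 <= s -> 0 <= t ->
  \sum_(y <- F) tp s x y * tp t y z <= tp (s + t) x z.
Proof.
move=> uF s0 t0; rewrite -lee_fin (transition_CK htp)//.
exact: esum_ge_seq.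
Qed.

Lemma transition_sum_le1 (F : seq S) t x : uniq F -> 0 <= t ->
  \sum_(y <- F) tp t x y <= 1.
Proof.
move=> uF t0; rewrite -lee_fin -(transition_sum1 htp x t0).
exact: esum_ge_seq.
Qed.

Variables (L : (S -> R) -> S -> R) (lam : R).
Hypothesis htpL : has_generator tp L.
Hypothesis L_pos : forall x, positive_functional (fun f => L f x + lam * f x).
Hypothesis L1 : forall x, L (cst 1) x = 0.

(** The factor exp(lam t) replaces the generator [L] by [L + lam], whose entries are
    non-negative. *)
Let pt t x y := expR (lam * t) * tp t x y.

Let pt_ge0 t x y : 0 <= t -> 0 <= pt t x y.
Proof. by move=> t0; rewrite mulr_ge0 ?expR_ge0// (transition_ge0 htp). Qed.

Let pt_CK_ge (F : seq S) s t x z : uniq F -> 0 <= s -> 0 <= t ->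
  \sum_(y <- F) pt s x y * pt t y z <= pt (s + t) x z.
Proof.
move=> uF s0 t0; rewrite /pt mulrDr expRD.
apply: le_trans (ler_wpM2l _ (transition_CK_ge x z uF s0 t0)).
  by rewrite mulr_sumr; apply: ler_sum => y _; rewrite le_eqVlt; apply/orP; left;
     apply/eqP; ring.
by rewrite mulr_ge0 ?expR_ge0.
Qed.

(** With h = t/n and [Q] the difference quotient, the left side of the assumed bound is t (Q h + lam
    (de + h Q h)), and h Q h vanishes as n grows. The factor 1 + lam h stands in for exp(lam h) to
    keep this identity algebraic. *)
Let generator_limit t x y (c : R) : 0 < t ->
  (forall n, (0 < n)%N ->
     n%:R * ((1 + lam * (t / n%:R)) * tp (t / n%:R) x y - (x == y)%:R) <= c) ->
  t * (L (indic_pt y) x + lam * (x == y)%:R) <= c.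
Proof.
move=> t0 H; set de : R := (x == y)%:R in H *.
pose Q h := (tp h x y - de) / h.
have QL : Q h @[h --> 0^'+] --> L (indic_pt y) x by exact: htpL.
have h0 : h @[h --> (0 : R)^'+] --> 0 by exact: cvg_within.
have lim : t * (Q h + lam * (de + h * Q h)) @[h --> 0^'+] -->
    t * (L (indic_pt y) x + lam * (de + 0 * L (indic_pt y) x)).
  apply: cvgMl_tmp; apply: cvgD => //; apply: cvgMl_tmp; apply: cvgD; first exact: cvg_cst.
  exact: cvgM.
have hn : t / n%:R @[n --> \oo] --> (0 : R)^'+.
  have hn0 : t / n%:R @[n --> \oo] --> (0 : R).
    rewrite -[0](mulr0 t); apply: cvgMl_tmp.
    rewrite -[X in X @ _ --> _]/((fun n => n%:R^-1)) -(cvg_shiftS _).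
    exact: cvg_harmonic.
  move=> A /(hn0 _) HA; change (\forall n \near \oo, A (t / n%:R)); near=> n.
  have : 0 < t / n%:R by rewrite divr_gt0// ltr0n; near: n; exists 1%N.
  by near: n; exact: HA.
have := cvg_comp _ _ hn lim; rewrite mul0r addr0 => {}lim.
apply: (cvgr_to_le lim); near=> n.
have n0 : (0 < n)%N by near: n; exists 1%N.
have nR : n%:R != 0 :> R by rewrite pnatr_eq0 -lt0n.
rewrite (le_trans _ (H n n0))//= /Q le_eqVlt; apply/orP; left; apply/eqP.
by field; rewrite nR gt_eqF.
Unshelve. all: by end_near. Qed.

Let bernoulli (b : R) n : 0 <= b -> 1 + n%:R * (b - 1) <= b ^+ n.
Proof.
move=> b0; elim: n => [|n IH]; first by rewrite mul0r addr0 expr0.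
rewrite exprS; apply: le_trans (ler_wpM2l b0 IH).
(* The product b (1 + n (b - 1)) exceeds 1 + (n + 1) (b - 1) by exactly n (b - 1)^2. *)
have : 0 <= n%:R * (b - 1) ^+ 2 by rewrite mulr_ge0// sqr_ge0.
rewrite -natr1; nra.
Qed.

Let pt_lin_le h x y : 0 <= h -> (1 + lam * h) * tp h x y <= pt h x y.
Proof.
move=> h0; rewrite /pt ler_wpM2r ?expR_ge1Dx// (transition_ge0 htp)//.
Qed.

(* Superadditivity in t; on the diagonal it comes from Bernoulli's inequality. *)
Let pt_diag t x : 0 < t ->
  t * (L (indic_pt x) x + lam * (x == x)%:R) <= pt t x x - (x == x)%:R.
Proof.
move=> t0; apply: generator_limit => // n n0; rewrite eqxx.
set h := t / n%:R; have h0 : 0 <= h by rewrite divr_ge0// ltW.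
apply: (@le_trans _ _ (n%:R * (pt h x x - 1))).
  by rewrite ler_wpM2l// lerB// pt_lin_le.
rewrite lerBrDl (le_trans (bernoulli _ (pt_ge0 _ _ h0)))//.
have -> : t = h * n%:R by rewrite divfK// pnatr_eq0 -lt0n.
elim: (n) => [|k IH].
  by rewrite expr0 mulr0 /pt mulr0 expR0 (transition_at0 htp) eqxx mul1r.
rewrite exprS -natr1 mulrDr mulr1 addrC.
have := @pt_CK_ge [:: x] h (h * k%:R) x x isT h0.
rewrite big_seq1 => /(_ (mulr_ge0 h0 (ler0n _ _))) H.
by rewrite (le_trans _ H)// ler_wpM2l// pt_ge0.
Qed.

Let L_ind_ge0 x y : 0 <= L (indic_pt y) x + lam * (x == y)%:R.
Proof. by apply: (positive_functional_ge0 (L_pos x)) => z; rewrite /indic_pt. Qed.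

Let pt_diag_ge1 t x : 0 <= t -> 1 <= pt t x x.
Proof.
rewrite le_eqVlt => /predU1P[<-|t0].
  by rewrite /pt mulr0 expR0 (transition_at0 htp) eqxx mul1r.
have := pt_diag x t0; rewrite [in leRHS]eqxx => H.
by rewrite -subr_ge0; apply: le_trans H; exact: mulr_ge0 (ltW t0) (L_ind_ge0 x x).
Qed.

(** Off the diagonal, Chapman-Kolmogorov restricted to the intermediate states x and y, with
    diagonal entries at least 1, makes [pt] superadditive in time. Hence n [pt] (t/n) <= [pt] t, and
    [generator_limit] lets n tend to infinity. *)
Let pt_ge t x y : 0 <= t ->
  (x == y)%:R + t * (L (indic_pt y) x + lam * (x == y)%:R) <= pt t x y.
Proof.
rewrite le_eqVlt => /predU1P[<-|t0].
  by rewrite /pt mulr0 expR0 (transition_at0 htp) mul0r addr0 mul1r.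
rewrite addrC -lerBrDr.
have [->|xy] : x = y \/ x != y by have [|] := eqVneq x y; [left|right].
  exact: pt_diag.
apply: generator_limit => // n n0; rewrite (negbTE xy) !subr0.
set h := t / n%:R; have h0 : 0 <= h by rewrite divr_ge0// ltW.
apply: (@le_trans _ _ (n%:R * pt h x y)).
  by rewrite ler_wpM2l// pt_lin_le.
have -> : t = h * n%:R by rewrite divfK// pnatr_eq0 -lt0n.
elim: (n) => [|k IH]; first by rewrite mul0r mulr0 pt_ge0.
have hk0 : 0 <= h * k%:R by rewrite mulr_ge0.
rewrite -natr1 mulrDr mulr1 addrC mulrDl mul1r addrC.
have := @pt_CK_ge [:: x; y] h (h * k%:R) x y _ h0 hk0.
rewrite /= inE xy => /(_ isT); rewrite big_cons big_seq1 [h + _]addrC.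
apply: le_trans; apply: lerD.
  by rewrite (le_trans IH)// ler_peMl ?pt_ge0// pt_diag_ge1.
by rewrite ler_peMr ?pt_ge0// pt_diag_ge1.
Qed.

Definition generator_step (h : R) (f : S -> R) : S -> R :=
  fun x => f x + h * (L f x + lam * f x).

Let step_pos h x : 0 <= h -> positive_functional (fun f => generator_step h f x).
Proof.
move=> h0; apply: positive_functionalD; first exact: positive_functional_eval.
exact: positive_functionalZ.
Qed.

Lemma generator_step_iter_pos m h x : 0 <= h ->
  positive_functional (fun f => iter m (generator_step h) f x).
Proof.
move=> h0; elim: m x => [|m IH] x; first exact: positive_functional_eval.
exact: (positive_functional_comp (step_pos x h0) IH).
Qed.

(** Each Euler step has finite support, so it is compared through [pt_ge] with the part of the
    Chapman-Kolmogorov sum over that support; the discarded terms are non-negative. *)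
Let pt_iter m h x z : 0 <= h ->
  iter m (generator_step h) (indic_pt z) x <= pt (h * m%:R) x z.
Proof.
move=> h0; elim: m x => [|m IH] x.
  by rewrite mulr0 /pt mulr0 expR0 (transition_at0 htp) mul1r.
rewrite iterS.
have [F /(_ _ (undup_uniq F)) HF] := positive_functional_support (step_pos x h0).
rewrite HF => [|y]; last by rewrite mem_undup.
rewrite -natr1 mulrDr mulr1 addrC.
have hm0 : 0 <= h * m%:R by rewrite mulr_ge0.
apply: le_trans (pt_CK_ge x z (undup_uniq F) h0 hm0).
apply: ler_sum => y _; rewrite mulrC; apply: ler_pM => //.
- by apply: (positive_functional_ge0 (step_pos x h0)) => w; rewrite /indic_pt.
- by apply: (positive_functional_ge0 (generator_step_iter_pos m y h0)) => w;
    rewrite /indic_pt.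
- exact: pt_ge.
Qed.

Let iter1 m h x : 0 <= h ->
  iter m (generator_step h) (cst 1) x = (1 + h * lam) ^+ m.
Proof.
move=> h0; elim: m x => [//|m IH] x; rewrite iterS.
(* [L] is an arbitrary map here; its linearity is available only through [positive_functionalDZ],
   whence the form 0 + c * 1. *)
rewrite (_ : iter m _ _ = fun y => 0 + (1 + h * lam) ^+ m * cst 1 y); last first.
  by apply/funext => y; rewrite IH add0r mulr1.
rewrite (positive_functionalDZ (cst 0) (cst 1) _ (step_pos x h0)).
have [w _ Hw] := step_pos x h0.
rewrite {1}Hw big1 => [|a _]; last by rewrite mulr0.
by rewrite add0r /generator_step L1 add0r mulr1 exprSr.
Qed.

(** The iterates lie below [tp t], which gives one inequality. For the other, a partial sum involves
    finitely many values of [f], so the missing mass contributes an error tending to 0 however fast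
    [f] grows. *)
Theorem transition_esum (f : S -> R) t x v : 0 <= t -> (forall y, 0 <= f y) ->
  expR (- (lam * t)) * iter m (generator_step (t / m%:R)) f x @[m --> \oo] --> v ->
  \esum_(y in [set: S]) (tp t x y * f y)%:E = v%:E.
Proof.
move=> t0 f0 fv.
pose pi m y := expR (- (lam * t)) * iter m (generator_step (t / m%:R)) (indic_pt y) x.
have pi_le m y : (0 < m)%N -> pi m y <= tp t x y.
  move=> m0; rewrite /pi mulrC expRN ler_pdivrMr ?expR_gt0// [leRHS]mulrC.
  have := pt_iter m x y (divr_ge0 t0 (ler0n _ m)).
  by rewrite divfK ?pnatr_eq0 -?lt0n.
have pi_ge0 m y : 0 <= pi m y.
  rewrite mulr_ge0 ?expR_ge0//; apply: (positive_functional_ge0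
    (generator_step_iter_pos m x (divr_ge0 t0 (ler0n _ m)))) => w.
  by rewrite /indic_pt.
have pi_supp m (F : seq S) : exists F', [/\ uniq F', {subset F <= F'} &
    forall g, \sum_(y <- F') pi m y * g y =
      expR (- (lam * t)) * iter m (generator_step (t / m%:R)) g x].
  have tm0 : 0 <= t / m%:R by rewrite divr_ge0.
  have [F0 HF] := positive_functional_support (generator_step_iter_pos m x tm0).
  exists (undup (F ++ F0)); split; first exact: undup_uniq.
    by move=> y yF; rewrite mem_undup mem_cat yF.
  move=> g; rewrite (HF (undup (F ++ F0))) ?undup_uniq//; last first.
    by move=> y yF; rewrite mem_undup mem_cat yF orbT.
  by rewrite mulr_sumr; apply: eq_bigr => y _; rewrite /pi; ring.
(* The iterates are below tp t and their total mass tends to 1, so each entry of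
   tp t exceeds the iterate by at most 1 - mass m. *)
pose mass m := expR (- (lam * t)) * (1 + t / m%:R * lam) ^+ m.
have mass1 : mass m @[m --> \oo] --> (1 : R).
  rewrite -(mulVf (lt0r_neq0 (expR_gt0 (lam * t)))) -expRN.
  apply: cvgMl_tmp; exact: expR_euler_cvg.
have tp_pi (F : seq S) m : uniq F -> (0 < m)%N ->
    \sum_(y <- F) tp t x y * f y <=
    expR (- (lam * t)) * iter m (generator_step (t / m%:R)) f x
    + (1 - mass m) * \sum_(y <- F) f y.
  move=> uF m0; have [F' [uF' FF' HF']] := pi_supp m F.
  have gap y : y \in F -> tp t x y <= pi m y + (1 - mass m).
    move=> yF; rewrite -lerBlDl.
    (* All differences are non-negative, so the one at y is at most their sum over [F'], which
       carries the whole mass of the iterate. *)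
    apply: (@le_trans _ _ (\sum_(z <- F') (tp t x z - pi m z))).
      rewrite (bigD1_seq y)/= ?FF'// lerDl sumr_ge0// => z _.
      by rewrite subr_ge0 pi_le.
    rewrite sumrB lerB ?transition_sum_le1//.
    have := HF' (cst 1); rewrite iter1 ?divr_ge0// -/(mass m) => <-.
    by under eq_bigr do rewrite mulr1.
  apply: (@le_trans _ _ (\sum_(y <- F) (pi m y * f y + (1 - mass m) * f y))).
    rewrite big_seq [leRHS]big_seq; apply: ler_sum => y yF.
    by rewrite -mulrDl ler_wpM2r// gap.
  rewrite big_split /= -mulr_sumr lerD2r -HF'.
  have E : perm_eq F [seq y <- F' | y \in F].
    apply: uniq_perm; rewrite ?filter_uniq// => y; rewrite mem_filter /=.
    by case: (boolP (y \in F)) => //= /FF' ->.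
  rewrite (perm_big _ E)/= big_filter [leRHS](bigID (mem F))/= lerDl sumr_ge0// => y _.
  by rewrite mulr_ge0.
apply/eqP; rewrite eq_le; apply/andP; split.
  apply: esum_le_seq => F uF.
  have lim : expR (- (lam * t)) * iter m (generator_step (t / m%:R)) f x
      + (1 - mass m) * (\sum_(y <- F) f y) @[m --> \oo] -->
      v + (1 - 1) * (\sum_(y <- F) f y).
    apply: cvgD => //; apply: cvgMr_tmp; apply: cvgB => //; exact: cvg_cst.
  rewrite subrr mul0r addr0 in lim.
  apply: (cvgr_to_ge lim); near=> m; apply: tp_pi => //.
  by near: m; exists 1%N.
case E : (\esum_(y in _) _) => [r| |]; last first.
- have : (0 <= \esum_(y in [set: S]) (tp t x y * f y)%:E)%E.
    by apply: esum_ge0 => y _; rewrite lee_fin mulr_ge0// (transition_ge0 htp).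
  by rewrite E.
- by rewrite leey.
rewrite lee_fin; apply: (cvgr_to_le fv); near=> m.
have [F [uF _ HF]] := pi_supp m [::].
rewrite -HF -lee_fin -E; apply: le_trans (esum_ge_seq _ uF).
rewrite lee_fin; apply: ler_sum => y _; rewrite ler_wpM2r// pi_le//.
by near: m; exists 1%N.
Unshelve. all: by end_near. Qed.

End transition.

(* Both sides evolve by the same Euler scheme: f is its own discretized flow
   because L maps the span of the f i to itself. *)
Theorem transition_esum_ode (R : realType) (S : choiceType) (I : finType)
    (tp : R -> S -> S -> R) (L : (S -> R) -> S -> R) (lam : R)
    (A : I -> I -> R) (f : I -> S -> R) (u : R -> I -> R) (x : S) :
  transition_function tp -> has_generator tp L ->
  (forall y, positive_functional (fun g => L g y + lam * g y)) ->
  (forall y, L (cst 1) y = 0) ->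
  (forall i y, 0 <= f i y) ->
  (forall i y, L (f i) y = matrix_act A (f ^~ y) i) ->
  (forall t i, 0 <= t -> has_derivative_Rplus (u ^~ i) t (matrix_act A (u t) i)) ->
  (forall i, u 0 i = f i x) ->
  forall t i, 0 <= t ->
    \esum_(y in [set: S]) (tp t x y * f i y)%:E = (u t i)%:E.
Proof.
move=> htp hL Lpos L1 f0 Lf ode u0 t i t0.
apply: (transition_esum htp hL Lpos L1 t0 (f0 i)).
pose M i j := A i j + lam * (i == j)%:R.
have actM w k : matrix_act M w k = matrix_act A w k + lam * w k.
  rewrite /matrix_act /M; under eq_bigr do rewrite mulrDl.
  rewrite big_split /=; congr (_ + _); rewrite (bigD1 k)//= eqxx mulr1 big1 ?addr0//.
  by move=> j jk; rewrite eq_sym (negbTE jk) mulr0 mul0r.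
pose v s j := expR (lam * s) * u s j.
have odev s j : 0 <= s -> has_derivative_Rplus (v ^~ j) s (matrix_act M (v s) j).
  move=> s0; have := has_derivative_Rplus_expRM (c := lam) (ode s j s0).
  suff -> : matrix_act M (v s) j = expR (lam * s) * (matrix_act A (u s) j + lam * u s j).
    by [].
  rewrite -actM /matrix_act mulr_sumr; apply: eq_bigr => k _; rewrite /v; ring.
have iterE h m j y : 0 <= h ->
    iter m (generator_step L lam h) (f j) y = iter m (euler_step M h) (f ^~ y) j.
  move=> h0; elim: m j => [//|m IH] j.
  (* The innermost step is peeled off: it turns [f j] into a combination of the [f k], and the
     remaining m steps act linearly on it. *)
  rewrite iterSr (_ : generator_step L lam h (f j) =
      fun z => f j z + h * (\sum_k M j k * f k z)); last first.
    by apply/funext => z; rewrite /generator_step Lf -/(matrix_act M (f ^~ z) j) actM.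
  have pf := generator_step_iter_pos Lpos m y h0.
  rewrite (positive_functionalDZ _ _ _ pf) (positive_functional_linear _ _ pf).
  rewrite iterS /euler_step IH; congr (_ + h * _).
  by apply: eq_bigr => k _; rewrite IH.
have -> : u t i = expR (- (lam * t)) * v t i.
  by rewrite /v mulrA -expRD addNr expR0 mul1r.
apply: cvgMl_tmp; have v0 : v 0 = f ^~ x.
  by apply/funext => j; rewrite /v mulr0 expR0 mul1r u0.
have := euler_cvg (i := i) odev t0; rewrite v0.
apply: cvg_trans; apply: near_eq_cvg; near=> m.
by rewrite iterE// divr_ge0.
Unshelve. all: by end_near. Qed.

(** * Expectations on a countable state space *)

Section discrete_expectation.
Context {R : realType} {d : measure_display} {Omega : measurableType d}.
Variables (P : probability Omega R) (S : choiceType) (code : S -> nat).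
Hypothesis code_inj : injective code.

(** The injection [code] makes the states countable, so the preimage of any set is a countable union
    of preimages of single states. *)
Lemma measurable_preimage_discrete (Y : Omega -> S) (A : set S) :
  (forall y, measurable (Y @^-1` [set y])) -> measurable (Y @^-1` A).
Proof.
move=> mY.
have -> : Y @^-1` A = \bigcup_n [set w | A (Y w) /\ code (Y w) = n].
  by apply/seteqP; split => w; [move=> Aw; exists (code (Y w))|case=> n _ []].
apply: bigcup_measurable => n _.
have [[y [Ay yn]]|H] := pselect (exists y, A y /\ code y = n).
  suff -> : [set w | A (Y w) /\ code (Y w) = n] = Y @^-1` [set y] by [].
  apply/seteqP; split => w /= => [[_ wn]|-> //].
  by apply: code_inj; rewrite wn.
suff -> : [set w | A (Y w) /\ code (Y w) = n] = set0 by [].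
by apply/seteqP; split => w //= HH; case: H; exists (Y w).
Qed.

(** Omega is cut into the level sets of [code] composed with [Y], on each of which the integrand is
    constant; numbers outside the range of [code] give empty cells. *)
Lemma expectation_discrete (Y : Omega -> S) (f : S -> R) :
  (forall y, measurable (Y @^-1` [set y])) -> (forall y, 0 <= f y) ->
  ('E_P[fun w => f (Y w)] = \esum_(y in [set: S]) (P (Y @^-1` [set y]) * (f y)%:E))%E.
Proof.
move=> mY f0; rewrite unlock.
pose F n := Y @^-1` [set y | code y = n].
have mF n : measurable (F n) by exact: measurable_preimage_discrete.
have FT : [set: Omega] = \bigcup_n F n.
  by apply/seteqP; split => w // _; exists (code (Y w)).
have tF : trivIset setT F.
  apply/trivIsetP => i j _ _ /eqP ij; apply/seteqP; split => w //= [wi wj].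
  by apply: ij; rewrite -wi -wj.
have Fy y : F (code y) = Y @^-1` [set y].
  by apply/seteqP; split => w; rewrite /F /=; [exact: code_inj|move->].
rewrite FT ge0_integral_bigcup//; last 2 first.
- move=> _ B mB; apply: measurableI; first by rewrite -FT.
  exact: (measurable_preimage_discrete [set y | B (f y)%:E]).
- by move=> w _; rewrite lee_fin.
rewrite nneseries_esum => [|n _]; last by apply: integral_ge0 => w _; rewrite lee_fin.
have -> : [set n : nat | true] = setT by apply/seteqP.
transitivity (\esum_(n in range code) \int[P]_(w in F n) (f (Y w))%:E)%E; last first.
  rewrite (@reindex_esum _ _ _ [set: S] (range code) code); last first.
    split; [by move=> y _; exists y|by move=> y z _ _; exact: code_inj|by []].
  apply: eq_esum => y _; rewrite Fy.
  rewrite (@eq_integral _ _ _ _ _ (cst (f y)%:E)); last first.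
    by move=> w; rewrite inE /= => ->.
  by rewrite integral_cst// muleC.
rewrite [RHS]esum_mkcond; apply: eq_esum => n _; case: ifPn => // /negP nr.
rewrite (_ : F n = set0) ?integral_set0//; apply/seteqP; split => w //= wn.
by case: nr; rewrite inE; exists (Y w).
Qed.

(** The Markov property with an empty past gives the joint law with the event that the process
    starts at [x0]; that event has probability 1, so intersecting with it changes nothing. *)
Lemma markov_process_law (X : R -> Omega -> S) tp x0 t y :
  markov_process P X tp x0 -> 0 <= t -> P (X t @^-1` [set y]) = (tp t x0 y)%:E.
Proof.
move=> [mX X0 mk] t0.
have nilP (r : R * S) : r \in [::] -> 0 <= r.1 <= 0 by [].
have := mk [::] 0 t x0 y (lexx 0) t0 nilP; rewrite add0r /=.
set A := [set w | _]; have -> : A = X 0 @^-1` [set x0].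
  by apply/seteqP; split => w /=; [case|].
rewrite X0 mul1e => <-.
have mA := mX 0 x0 (lexx 0); have mB := mX t y t0.
rewrite (measureDI P mB mA) setIC [X in (X + _)%E](_ : _ = 0%E) ?add0e//.
apply/eqP; rewrite eq_le measure_ge0 andbT.
apply: (@le_trans _ _ (P (~` (X 0 @^-1` [set x0])))).
  apply: le_measure; rewrite ?inE; [exact: measurableD|exact: measurableC|].
  by move=> w [].
by rewrite probability_setC// X0 subee.
Qed.

End discrete_expectation.

(** * Positivity of the ASEP generator up to a constant *)

Section asep_generator.
Context {R : realType} (l : nat) (pp qq alpha beta gamma delta : R).
Local Notation L := (asep_generator pp qq alpha beta gamma delta).
Implicit Types (s : asep_state l) (f : asep_state l -> R).

(** The expression equals r f(y) + (c - r) f(x). *)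
Lemma jump_positive_functional (S : choiceType) (x y : S) (r c : R) :
  0 <= r <= c -> positive_functional (fun f : S -> R => r * (f y - f x) + c * f x).
Proof.
move=> /andP[r0 rc].
have [w w0 Hw] := positive_functionalD
  (positive_functionalZ r0 (positive_functional_eval y))
  (positive_functionalZ (etrans (subr_ge0 _ _) rc) (positive_functional_eval x)).
by exists w => // f; rewrite -Hw; ring.
Qed.

(** A bound on the total exit rate that is uniform in the state: every occupation factor is replaced
    by 1. *)
Definition asep_rate_bound : R :=
  \sum_(i : 'I_l.-1) \sum_(j : 'I_l.-1 | j == i.+1 :> nat) (pp + qq)
  + \sum_(i : 'I_l.-1 | i == 0%N :> nat) (alpha + gamma)
  + \sum_(i : 'I_l.-1 | i.+1 == l.-1 :> nat) (delta + beta).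

Hypotheses (pp0 : 0 <= pp) (qq0 : 0 <= qq) (alpha0 : 0 <= alpha)
  (beta0 : 0 <= beta) (gamma0 : 0 <= gamma) (delta0 : 0 <= delta).

(** The bound is shared out among the transitions, each receiving its own maximal rate, and every
    summand is then positive by [jump_positive_functional]. *)
Lemma asep_generator_positive s :
  positive_functional (fun f => L f s + asep_rate_bound * f s).
Proof.
have rate (c : R) (b : bool) : 0 <= c -> 0 <= c * b%:R <= c.
  by move=> c0; case: b; rewrite ?mulr1 ?mulr0 ?lexx ?c0.
set T := fun (rate : R) s' (f : asep_state l -> R) => rate * (f s' - f s).
have pair (c c' : R) (b b' : bool) s1 s2 : 0 <= c -> 0 <= c' ->
    positive_functional (fun f =>
      T (c * b%:R) s1 f + T (c' * b'%:R) s2 f + (c + c') * f s).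
  move=> c0 c0'.
  have [w w0 Hw] := positive_functionalD
    (jump_positive_functional s s1 (rate c b c0))
    (jump_positive_functional s s2 (rate c' b' c0')).
  by exists w => // f; rewrite -Hw /T; ring.
have -> : (fun f => L f s + asep_rate_bound * f s) = (fun f =>
    \sum_(i : 'I_l.-1) \sum_(j : 'I_l.-1 | j == i.+1 :> nat)
      (T (pp * (s.1 i && ~~ s.1 j)%:R) (set_occ (set_occ s.1 i false) j true, s.2) f
       + T (qq * (s.1 j && ~~ s.1 i)%:R) (set_occ (set_occ s.1 j false) i true, s.2) f
       + (pp + qq) * f s)
    + \sum_(i : 'I_l.-1 | i == 0%N :> nat)
      (T (alpha * (~~ s.1 i)%:R) (set_occ s.1 i true, s.2) f
       + T (gamma * (s.1 i)%:R) (set_occ s.1 i false, s.2) f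
       + (alpha + gamma) * f s)
    + \sum_(i : 'I_l.-1 | i.+1 == l.-1 :> nat)
      (T (delta * (~~ s.1 i)%:R) (set_occ s.1 i true, s.2 - 1) f
       + T (beta * (s.1 i)%:R) (set_occ s.1 i false, s.2 + 1) f
       + (delta + beta) * f s)).
  have E (J : finType) (P : pred J) (F c : J -> R) y :
      \sum_(j | P j) (F j + c j * y) = \sum_(j | P j) F j + (\sum_(j | P j) c j) * y.
    by rewrite big_split mulr_suml.
  apply/funext => f; rewrite /asep_rate_bound /asep_generator /= -!/(T _ _ f).
  have Ec (J : finType) (P : pred J) (F : J -> R) (c : R) y :
      \sum_(j | P j) (F j + c * y) = \sum_(j | P j) F j + (\sum_(j | P j) c) * y.
    exact: (E _ P F (fun=> c)).
  under [in RHS]eq_bigr do rewrite Ec.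
  rewrite E !Ec.
  by ring.
apply: positive_functionalD; last by apply: positive_functional_sum => i _; exact: pair.
apply: positive_functionalD; last by apply: positive_functional_sum => i _; exact: pair.
apply: positive_functional_sum => i _; apply: positive_functional_sum => j _.
exact: pair.
Qed.

Lemma asep_generator_const s : L (cst 1) s = 0.
Proof.
rewrite /asep_generator /=.
rewrite big1 => [|i _]; last by rewrite big1 // => j _; rewrite !subrr !mulr0 addr0.
by rewrite !big1 ?addr0// => i _; rewrite !subrr !mulr0 addr0.
Qed.

Lemma asep_generator_linear (J : finType) (c : J -> R) (g : J -> asep_state l -> R) s :
  L (fun s' => \sum_j c j * g j s') s = \sum_j c j * L (g j) s.
Proof.
apply: (addIr (asep_rate_bound * (\sum_j c j * g j s))).
rewrite (positive_functional_linear c g (asep_generator_positive s)).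
rewrite mulr_sumr -big_split /=; apply: eq_bigr => j _; ring.
Qed.

End asep_generator.

(** * Effect of each transition on the heights and on Q *)

Lemma height_set_occ (l : nat) (eta : config l) (N : int) (k : 'I_l.-1) (b : bool) (z : int) :
  height (set_occ eta k b, N) z =
  height (eta, N) z + (if z <= k.+1%:Z then b%:Z - (eta k)%:Z else 0).
Proof.
rewrite /height /= big_mkcond [in RHS]big_mkcond /= (bigD1 k)//= [in RHS](bigD1 k)//=.
rewrite (eq_bigr (fun j : 'I_l.-1 => if z <= j.+1%:Z then (eta j : nat)%:Z else 0)).
  by rewrite ffunE eqxx; case: ifP => _; ring.
by move=> j jk; rewrite ffunE (negbTE jk).
Qed.

Lemma height_succ (l : nat) (eta : config l) (N : int) (k : 'I_l.-1) :
  height (eta, N) k.+1%:Z = height (eta, N) k.+2%:Z + (eta k)%:Z.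
Proof.
rewrite /height /= (bigD1 k)//= [RHS]addrAC; congr (_ + _); rewrite [LHS]addrC.
by congr (_ + _); apply: eq_bigl => j; rewrite -val_eqE /=; lia.
Qed.

Section duality_function.
Context {R : realType} (l : nat) (q : R).
Hypothesis q_gt0 : 0 < q.
Implicit Types (eta : config l) (N z : int).

Let q_neq0 : q != 0. Proof. by rewrite gt_eqF. Qed.

Lemma duality_Q_shift (s s' : asep_state l) z (e : int) :
  height s' z = height s z + e -> duality_Q q s' z = q ^ e * duality_Q q s z.
Proof. by move=> h; rewrite /duality_Q h expfzDr// mulrC. Qed.

(** Partial sums starting further left contain both ends of the bond and those starting further
    right contain neither; only the one starting at the right end, site j + 1, changes. *)
Lemma duality_Q_jump_right eta N (i j : 'I_l.-1) z :
  j = i.+1 :> nat -> eta i -> ~~ eta j ->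
  duality_Q q (set_occ (set_occ eta i false) j true, N) z =
  (if z == j.+1%:Z then q else 1) * duality_Q q (eta, N) z.
Proof.
move=> ji ei ej; rewrite (@duality_Q_shift (eta, N) _ _ (z == j.+1%:Z)%:Z).
  by case: eqP.
have nji : (j == i) = false by apply/eqP => E; move: ji; rewrite E; lia.
rewrite !height_set_occ ffunE nji ei (negbTE ej).
by case: (eqVneq z j.+1%:Z) => /= ?; do 2!case: ifP; move: ji; lia.
Qed.

Lemma duality_Q_jump_left eta N (i j : 'I_l.-1) z :
  j = i.+1 :> nat -> eta j -> ~~ eta i ->
  duality_Q q (set_occ (set_occ eta j false) i true, N) z =
  (if z == j.+1%:Z then q^-1 else 1) * duality_Q q (eta, N) z.
Proof.
move=> ji ej ei; rewrite (@duality_Q_shift (eta, N) _ _ (- (z == j.+1%:Z)%:Z)).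
  by case: eqP => _; rewrite ?oppr0 ?expr0z ?exprN1.
have nij : (i == j) = false by apply/eqP => E; move: ji; rewrite E; lia.
rewrite !height_set_occ ffunE nij (negbTE ei) ej.
by case: (eqVneq z j.+1%:Z) => /= ?; do 2!case: ifP; move: ji; lia.
Qed.

Lemma duality_Q_left eta N (i : 'I_l.-1) b z :
  i = 0%N :> nat -> 1 <= z -> eta i = ~~ b ->
  duality_Q q (set_occ eta i b, N) z =
  (if z == 1 then if b then q else q^-1 else 1) * duality_Q q (eta, N) z.
Proof.
move=> i0 z1 eb.
rewrite (@duality_Q_shift (eta, N) _ _ (if z == 1 then b%:Z - (~~ b)%:Z else 0)).
  by case: eqP => _; case: b {eb}; rewrite ?expr0z ?exprN1.
rewrite height_set_occ eb i0.
by congr (_ + _); case: (eqVneq z 1) => /= ?; case: ifP; move: z1; lia.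
Qed.

(** For z < l the change of occupation at site l - 1 is cancelled by the change of N; at z = l the
    sum over sites is empty and only N is seen. *)
Lemma duality_Q_right eta N (i : 'I_l.-1) (b : bool) z :
  i.+1 = l.-1 -> z <= l%:Z -> eta i = ~~ b ->
  duality_Q q (set_occ eta i b, N + (if b then -1 else 1)) z =
  (if z == l%:Z then if b then q^-1 else q else 1) * duality_Q q (eta, N) z.
Proof.
move=> il zl eb; have := ltn_ord i => il'.
rewrite (@duality_Q_shift (eta, N) _ _
  (if z == l%:Z then (~~ b)%:Z - b%:Z else 0)).
  by case: eqP => _; case: b {eb}; rewrite ?expr0z ?exprN1.
rewrite height_set_occ eb il /height /= !addrA.
by case: b {eb} => /=; case: (eqVneq z l%:Z) => /= ?; case: ifP; lia.
Qed.

End duality_function.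

(** * The Weyl chamber as a finite type *)

Section weyl_chamber.
Variables (n l : nat).
Implicit Types x : {ffun 'I_n -> int}.

Lemma weyl_chamber_inj x : weyl_chamber l x -> injective x.
Proof.
move=> [_ xlt] i j xij; case: (ltngtP i j) => [/xlt|/xlt|/ord_inj//].
  by rewrite xij ltxx.
by rewrite xij ltxx.
Qed.

Definition int_coord (k : {ffun 'I_n -> 'I_l.+1}) : {ffun 'I_n -> int} :=
  [ffun i => (k i : nat)%:Z].

(** The index set of the finite linear system. Coordinates are ordinals below l + 1 taken at face
    value; the predicate excludes 0. *)
Definition weyl_index : finType := {k | `[< weyl_chamber l (int_coord k) >]}.

Definition weyl_point (k : weyl_index) : {ffun 'I_n -> int} := int_coord (val k).

Lemma weyl_pointP k : weyl_chamber l (weyl_point k).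
Proof. exact/asboolP/(valP k). Qed.

Lemma weyl_point_surj x : weyl_chamber l x -> exists k, weyl_point k = x.
Proof.
move=> xW; have abs (z : int) : 1 <= z <= l%:Z -> `|z|%N%:Z = z /\ (`|z| < l.+1)%N.
  by lia.
pose k0 : {ffun 'I_n -> 'I_l.+1} := [ffun i => inord `|x i|%N].
have E : int_coord k0 = x.
  by apply/ffunP => i; rewrite !ffunE inordK; case: (abs (x i) (xW.1 i)).
have H : `[< weyl_chamber l (int_coord k0) >] by apply/asboolP; rewrite E.
by exists (exist (fun k => is_true `[< weyl_chamber l (int_coord k) >]) k0 H).
Qed.

(** Only the preceding coordinate can block the move: if i + 1 < j, a coordinate lies strictly
    between x_i and x_j, which leaves a gap of at least 2. *)
Lemma shift_coord_weyl_left x j : weyl_chamber l x -> x j != 1 ->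
  (forall i : 'I_n, nat_of_ord j = i.+1 -> x j != x i + 1) ->
  weyl_chamber l (shift_coord x j (-1)).
Proof.
move=> [xin xlt] xj1 free; split=> [i|i i' ii']; rewrite !ffunE.
  by have := xin i; case: eqP => [->|_]; move: xj1; lia.
have [ij|ij] := eqVneq i j; have [i'j|i'j] := eqVneq i' j; have := xlt i i' ii';
  rewrite ?ij ?i'j; try lia.
move=> xij; have [ji|ji] := eqVneq (nat_of_ord j) i.+1.
  by have := free i ji; lia.
have ii1j : (i.+1 < j)%N by move: ii'; rewrite i'j; lia.
pose i1 := Ordinal (ltn_trans ii1j (ltn_ord j)).
by have := xlt i i1 (ltnSn i); have := xlt i1 j ii1j; lia.
Qed.

Lemma shift_coord_weyl_right x i : weyl_chamber l x -> x i != l%:Z ->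
  (forall j : 'I_n, nat_of_ord j = i.+1 -> x j != x i + 1) ->
  weyl_chamber l (shift_coord x i 1).
Proof.
move=> [xin xlt] xil free; split=> [j|j j' jj']; rewrite !ffunE.
  by have := xin j; case: eqP => [->|_]; move: xil; lia.
have [ji|ji] := eqVneq j i; have [j'i|j'i] := eqVneq j' i; have := xlt j j' jj';
  rewrite ?ji ?j'i; try lia.
move=> xij; have [ij'|ij'] := eqVneq (nat_of_ord j') i.+1.
  by have := free j' ij'; lia.
have i1j : (i.+1 < j')%N by move: jj'; rewrite ji; lia.
pose i1 := Ordinal (ltn_trans i1j (ltn_ord j')).
by have := xlt i i1 (ltnSn i); have := xlt i1 j' i1j; lia.
Qed.

End weyl_chamber.

(** * Boundary relations and duality *)

Section duality.
Context {R : realType} (l n : nat) (pp qq alpha beta gamma delta : R).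
Local Notation L := (asep_generator pp qq alpha beta gamma delta).
Local Notation q := (qq / pp).
Local Notation c0 := (alpha / pp * q + 1 - alpha / pp).
Local Notation cl := (delta / qq / q + 1 - delta / qq).
Local Notation weyl_index := (weyl_index n l).
Implicit Types (x : {ffun 'I_n -> int}) (s : asep_state l).

Definition duality_Q_ext (s : asep_state l) (z : int) : R :=
  if z < 1 then c0 * duality_Q q s 1
  else if l%:Z < z then cl * duality_Q q s l%:Z else duality_Q q s z.

Definition duality_H_ext s x : R := \prod_(i < n) duality_Q_ext s (x i).

Lemma duality_Q_ext_in s (z : int) : 1 <= z <= l%:Z ->
  duality_Q_ext s z = duality_Q q s z.
Proof. by rewrite /duality_Q_ext; case: ifP; [lia|]; case: ifP => //; lia. Qed.

Lemma duality_H_ext_in s x : in_box 1 l%:Z x -> duality_H_ext s x = duality_H q s x.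
Proof. by move=> xin; apply: eq_bigr => i _; rewrite duality_Q_ext_in. Qed.

Definition boundary_relations (g : {ffun 'I_n -> int} -> R) : Prop :=
  [/\ forall x (i j : 'I_n), weyl_chamber l x -> nat_of_ord j = i.+1 ->
        x j = x i + 1 ->
        pp * g (shift_coord x j (-1)) + qq * g (shift_coord x i 1) = (pp + qq) * g x,
      forall x (i : 'I_n), weyl_chamber l x -> nat_of_ord i = 0%N -> x i = 1 ->
        g (shift_coord x i (-1)) = c0 * g x
    & forall x (i : 'I_n), weyl_chamber l x -> i.+1 = n -> x i = l%:Z ->
        g (shift_coord x i 1) = cl * g x].

(** The coefficients are chosen before [g], so one matrix row serves [u] at all times and the
    extended H at all states. *)
Definition weyl_representable (Phi : ({ffun 'I_n -> int} -> R) -> R) : Prop :=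
  exists c : weyl_index -> R, forall g, boundary_relations g ->
    Phi g = \sum_k c k * g (weyl_point k).

Lemma weyl_representable0 : weyl_representable (fun=> 0).
Proof. by exists (fun=> 0) => g _; rewrite big1// => k _; rewrite mul0r. Qed.

Lemma weyl_representable_eval x : weyl_chamber l x -> weyl_representable (fun g => g x).
Proof.
move=> /weyl_point_surj[k <-]; exists (fun j => (j == k)%:R) => g _.
rewrite (bigD1 k)//= eqxx mul1r big1 ?addr0// => j /negbTE ->.
by rewrite mul0r.
Qed.

Lemma weyl_representableD Phi Psi : weyl_representable Phi ->
  weyl_representable Psi -> weyl_representable (fun g => Phi g + Psi g).
Proof.
move=> [c Hc] [c' Hc']; exists (fun k => c k + c' k) => g gr.
by rewrite Hc// Hc'// -big_split; apply: eq_bigr => k _; rewrite mulrDl.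
Qed.

Lemma weyl_representableZ (a : R) Phi :
  weyl_representable Phi -> weyl_representable (fun g => a * Phi g).
Proof.
move=> [c Hc]; exists (fun k => a * c k) => g gr.
by rewrite Hc// mulr_sumr; apply: eq_bigr => k _; rewrite mulrA.
Qed.

Lemma weyl_representable_sum (J : finType) (Phi : J -> ({ffun 'I_n -> int} -> R) -> R) :
  (forall j, weyl_representable (Phi j)) ->
  weyl_representable (fun g => \sum_j Phi j g).
Proof.
move=> /choice[c Hc]; exists (fun k => \sum_j c j k) => g gr.
under [RHS]eq_bigr do rewrite mulr_suml.
by rewrite exchange_big; apply: eq_bigr => j _; rewrite Hc.
Qed.

Lemma weyl_representable_ext Phi Psi : weyl_representable Phi ->
  (forall g, boundary_relations g -> Psi g = Phi g) -> weyl_representable Psi.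
Proof. by move=> [c Hc] H; exists c => g gr; rewrite H// Hc. Qed.

(* The terms of Delta that leave the chamber by a collision x_j = x_i + 1 with
   j = i + 1 cancel in pairs by the first boundary relation; those that leave
   it through 0 or l + 1 are rescaled by the other two. *)
Lemma Delta_representable x : weyl_chamber l x ->
  weyl_representable (fun g => Delta pp qq g x).
Proof.
move=> xW; have xlt := xW.2; have xin := xW.1.
pose hit (i j : 'I_n) := (nat_of_ord j == i.+1) && (x j == x i + 1).
pose F j g := pp * (g (shift_coord x j (-1)) - g x).
pose G i g := qq * (g (shift_coord x i 1) - g x).
(* The factor 1 minus the number of hits is 0 for a move blocked by the neighbouring coordinate and
   1 otherwise. For a hitting pair the collision relation says [F j g + G i g = 0]. *)
apply: (@weyl_representable_ext (fun g =>
   \sum_j (1 - \sum_i (hit i j)%:R) * F j g +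
   \sum_i (1 - \sum_j (hit i j)%:R) * G i g)); last first.
  move=> g [gc _ _].
  have hit0 : \sum_i \sum_j (hit i j)%:R * (F j g + G i g) = 0.
    rewrite big1// => i _; rewrite big1// => j _.
    rewrite /hit; case: eqP => [ji|_] /=; last by rewrite mul0r.
    case: eqP => [xji|_] /=; last by rewrite mul0r.
    have := gc x i j xW ji xji; rewrite mul1r /F /G => E; lra.
  have E1 : \sum_j (1 - \sum_i (hit i j)%:R) * F j g =
      \sum_j F j g - \sum_i \sum_j (hit i j)%:R * F j g.
    rewrite exchange_big -sumrB; apply: eq_bigr => j _.
    by rewrite mulrBl mul1r mulr_suml.
  have E2 : \sum_i (1 - \sum_j (hit i j)%:R) * G i g =
      \sum_i G i g - \sum_i \sum_j (hit i j)%:R * G i g.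
    rewrite -sumrB; apply: eq_bigr => i _.
    by rewrite mulrBl mul1r mulr_suml.
  have E3 : \sum_i \sum_j (hit i j)%:R * F j g =
      - \sum_i \sum_j (hit i j)%:R * G i g.
    apply/eqP; rewrite -addr_eq0 -big_split /= -[X in _ == X]hit0; apply/eqP.
    apply: eq_bigr => i _; rewrite -big_split; apply: eq_bigr => j _.
    by rewrite mulrDr.
  rewrite E1 E2 E3 opprK addrACA subrr addr0 -big_split; apply: eq_bigr => i _.
  by rewrite /F /G /=; ring.
apply: weyl_representableD; apply: weyl_representable_sum => j.
- have [[i hij]|free] := pselect (exists i, hit i j).
    rewrite (bigD1 i)//= hij big1 ?addr0 ?subrr.
      by apply: weyl_representable_ext weyl_representable0 _ => g _; rewrite mul0r.
    move=> i' i'i; case: (boolP (hit i' j)) => // /andP[/eqP ji' _].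
    move: hij => /andP[/eqP ji _]; case/eqP: i'i; apply: ord_inj; lia.
  apply/weyl_representableZ/weyl_representableZ.
  apply: weyl_representableD; last first.
    apply: weyl_representable_ext (weyl_representableZ (-1) (weyl_representable_eval xW)) _.
    by move=> g _; rewrite mulN1r.
  have free' (i : 'I_n) : nat_of_ord j = i.+1 -> x j != x i + 1.
    by move=> ji; apply/eqP => xji; apply: free; exists i; rewrite /hit ji xji !eqxx.
  have [xj1|xj1] := eqVneq (x j) 1; last first.
    exact/weyl_representable_eval/shift_coord_weyl_left.
  apply: weyl_representable_ext (weyl_representableZ c0 (weyl_representable_eval xW)) _.
  move=> g [_ gl _]; apply: gl => //.
  case: (posnP (nat_of_ord j)) => // j0.
  have jP : (j.-1 < n)%N by have := ltn_ord j; lia.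
  have := xlt (Ordinal jP) j; have := xin (Ordinal jP); rewrite /= xj1; lia.
- have [[i hij]|free] := pselect (exists i, hit j i).
    rewrite (bigD1 i)//= hij big1 ?addr0 ?subrr.
      by apply: weyl_representable_ext weyl_representable0 _ => g _; rewrite mul0r.
    move=> i' i'i; case: (boolP (hit j i')) => // /andP[/eqP ji' _].
    move: hij => /andP[/eqP ji _]; case/eqP: i'i; apply: ord_inj; lia.
  apply/weyl_representableZ/weyl_representableZ.
  apply: weyl_representableD; last first.
    apply: weyl_representable_ext (weyl_representableZ (-1) (weyl_representable_eval xW)) _.
    by move=> g _; rewrite mulN1r.
  have free' (i : 'I_n) : nat_of_ord i = j.+1 -> x i != x j + 1.
    by move=> ji; apply/eqP => xji; apply: free; exists i; rewrite /hit ji xji !eqxx.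
  have [xjl|xjl] := eqVneq (x j) l%:Z; last first.
    exact/weyl_representable_eval/shift_coord_weyl_right.
  apply: weyl_representable_ext (weyl_representableZ cl (weyl_representable_eval xW)) _.
  move=> g [_ _ gl]; apply: gl => //.
  apply/eqP; rewrite eqn_leq ltn_ord /= leqNgt; apply/negP => jP.
  have := xlt j (Ordinal jP) (ltnSn j); have := xin (Ordinal jP); rewrite /= xjl; lia.
Qed.

Hypotheses (hl : (2 <= l)%N) (hq : 0 < qq) (hpq : qq < pp).
Hypotheses (hleft : alpha / pp + gamma / qq = 1) (hright : beta / pp + delta / qq = 1).

Let pp_gt0 : 0 < pp. Proof. exact: lt_trans hpq. Qed.
Let q_gt0 : 0 < q. Proof. by rewrite divr_gt0. Qed.

(** Only one place acts on Q_z: the bond with right end z, or the left reservoir if z = 1, or the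
    right one if z = l. Neighbouring values of Q differ by a factor 1 or q according to occupation,
    which leaves a check on one or two occupation variables. *)
Lemma asep_generator_duality_Q (s : asep_state l) (z : int) : 1 <= z <= l%:Z ->
  L (fun s' => duality_Q q s' z) s =
  pp * duality_Q_ext s (z - 1) + qq * duality_Q_ext s (z + 1)
  - (pp + qq) * duality_Q_ext s z.
Proof.
move=> /andP[z1 zl]; case: s => eta N.
have pn : pp != 0 by rewrite gt_eqF.
have qn : qq != 0 by rewrite gt_eqF.
set a := duality_Q q (eta, N) z.
have bulk (i j : 'I_l.-1) : j = i.+1 :> nat ->
    pp * (eta i && ~~ eta j)%:R *
      (duality_Q q (set_occ (set_occ eta i false) j true, N) z - a)
    + qq * (eta j && ~~ eta i)%:R *
      (duality_Q q (set_occ (set_occ eta j false) i true, N) z - a) =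
    if z == j.+1%:Z then
      (pp * (eta i && ~~ eta j)%:R * (q - 1)
       + qq * (eta j && ~~ eta i)%:R * (q^-1 - 1)) * a
    else 0.
  move=> ji; transitivity
      ((if z == j.+1%:Z then pp * (eta i && ~~ eta j)%:R * (q - 1) * a else 0) +
       (if z == j.+1%:Z then qq * (eta j && ~~ eta i)%:R * (q^-1 - 1) * a else 0)).
    congr (_ + _).
    - have [/andP[ei ej]|_] := boolP (eta i && ~~ eta j); last first.
        by rewrite mulr0 !mul0r if_same.
      by rewrite (duality_Q_jump_right q_gt0)// -/a; case: (z == _); ring.
    - have [/andP[ei ej]|_] := boolP (eta j && ~~ eta i); last first.
        by rewrite mulr0 !mul0r if_same.
      by rewrite (duality_Q_jump_left q_gt0)// -/a; case: (z == _); ring.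
  by case: (z == _); ring.
have left (i : 'I_l.-1) : i = 0%N :> nat ->
    alpha * (~~ eta i)%:R * (duality_Q q (set_occ eta i true, N) z - a)
    + gamma * (eta i)%:R * (duality_Q q (set_occ eta i false, N) z - a) =
    if z == 1 then (alpha * (~~ eta i)%:R * (q - 1)
                    + gamma * (eta i)%:R * (q^-1 - 1)) * a else 0.
  move=> i0; have [ei|/negbTE ei] := boolP (eta i) => /=;
    [rewrite (@duality_Q_left _ _ _ q_gt0 eta N i false z)//
    |rewrite (@duality_Q_left _ _ _ q_gt0 eta N i true z)//];
    rewrite -/a; case: (z == _) => /=; ring.
have right (i : 'I_l.-1) : i.+1 = l.-1 ->
    delta * (~~ eta i)%:R * (duality_Q q (set_occ eta i true, N - 1) z - a)
    + beta * (eta i)%:R * (duality_Q q (set_occ eta i false, N + 1) z - a) =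
    if z == l%:Z then (delta * (~~ eta i)%:R * (q^-1 - 1)
                    + beta * (eta i)%:R * (q - 1)) * a else 0.
  move=> il; have [ei|/negbTE ei] := boolP (eta i) => /=;
    [rewrite (@duality_Q_right _ _ _ q_gt0 eta N i false z)//
    |rewrite (@duality_Q_right _ _ _ q_gt0 eta N i true z)//];
    rewrite -/a; case: (z == _) => /=; ring.
have succ (k : 'I_l.-1) :
    duality_Q q (eta, N) k.+1%:Z = (if eta k then q else 1) * duality_Q q (eta, N) k.+2%:Z.
  rewrite {1}/duality_Q height_succ expfzDr ?gt_eqF// mulrC.
  by case: (eta k); rewrite ?expr1z ?expr0z.
rewrite /asep_generator /=.
rewrite (eq_bigr _ (fun i _ => eq_bigr _ (fun j ji => bulk i j (eqP ji)))).
rewrite [X in _ + X + _](eq_bigr _ (fun i i0 => left i (eqP i0))).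
rewrite [X in _ + _ + X](eq_bigr _ (fun i il => right i (eqP il))).
have lne1 : (1 == l%:Z) = false by apply/eqP; lia.
have [z_1|z_ne1] := eqVneq z 1.
  have i0P : (0 < l.-1)%N by lia.
  rewrite big1 => [|i _]; last first.
    by rewrite big1// => j /eqP ji; case: eqP => //; move: ji; lia.
  rewrite (big_pred1 (Ordinal i0P)) => [|i]; last by rewrite /pred1 /= -val_eqE.
  rewrite big1 => [|i _]; last by case: eqP => //; lia.
  rewrite add0r addr0.
  have := succ (Ordinal i0P); rewrite /a z_1 /= => ->.
  rewrite /duality_Q_ext subrr ltr01 ltxx.
  have -> : (1 + 1 < 1 :> int) = false by lia.
  have -> : (l%:Z < 1 + 1) = false by lia.
  have -> : (l%:Z < 1) = false by lia.
  have := succ (Ordinal i0P); rewrite /= => ->.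
  (* With site 1 empty the identity is the definition of the boundary factor; with site 1 occupied
     it is the relation between alpha and gamma. The right end is analogous with delta and beta. *)
  have -> : gamma = qq * (1 - alpha / pp) by rewrite -hleft; field; rewrite pn qn.
  by case: (eta _) => /=; field; rewrite pn qn.
have [z_l|z_nel] := eqVneq z l%:Z.
  have i0P : (l.-2 < l.-1)%N by lia.
  rewrite big1 => [|i _]; last first.
    by rewrite big1// => j _; have jl := ltn_ord j; case: eqP => //; lia.
  rewrite [\sum_(i < l.-1 | i == 0%N :> nat) _]big1//.
  rewrite (big_pred1 (Ordinal i0P)) => [|i]; last by rewrite /pred1 /= -val_eqE /=; lia.
  rewrite !add0r /a z_l.
  rewrite /duality_Q_ext ltxx.
  have -> : (l%:Z - 1 < 1 :> int) = false by lia.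
  have -> : (l%:Z < l%:Z - 1) = false by lia.
  have -> : (l%:Z + 1 < 1 :> int) = false by lia.
  have -> : (l%:Z < l%:Z + 1) = true by lia.
  have -> : (l%:Z < 1) = false by lia.
  have := succ (Ordinal i0P).
  have -> : (Ordinal i0P).+1%:Z = l%:Z - 1 by rewrite /=; lia.
  have -> : (Ordinal i0P).+2%:Z = l%:Z by rewrite /=; lia.
  move=> ->.
  have -> : beta = pp * (1 - delta / qq) by rewrite -hright; field; rewrite pn qn.
  by case: (eta _) => /=; field; rewrite pn qn.
(* Now 2 <= z <= l - 1, and the ordinals k and k + 1 are the sites z - 1 and z. *)
have [k zk] : exists k : nat, z = k.+2%:Z by exists (`|z|%N - 2)%N; lia.
have kP : (k.+1 < l.-1)%N by lia.
pose j0 := Ordinal kP; pose i0 : 'I_l.-1 := Ordinal (ltnW kP).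
rewrite [\sum_(i < l.-1 | i == 0%N :> nat) _]big1//.
rewrite [\sum_(i < l.-1 | i.+1 == l.-1 :> nat) _]big1//.
rewrite (bigD1 i0)//= [\sum_(i < l.-1 | i != i0) _]big1 => [|i ii0]; last first.
  rewrite big1// => j /eqP ji; case: eqP => //; rewrite zk ji => -[ik].
  by case/eqP: ii0; apply: val_inj => /=; lia.
rewrite (big_pred1 j0) => [|j]; last by rewrite /pred1 /= -val_eqE.
rewrite !addr0 zk eqxx /a zk.
rewrite /duality_Q_ext.
have -> : (k.+2%:Z - 1 < 1 :> int) = false by lia.
have -> : (l%:Z < k.+2%:Z - 1) = false by lia.
have -> : (k.+2%:Z + 1 < 1 :> int) = false by lia.
have -> : (l%:Z < k.+2%:Z + 1) = false by lia.
have -> : (k.+2%:Z < 1 :> int) = false by lia.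
have -> : (l%:Z < k.+2%:Z) = false by lia.
have -> : k.+2%:Z - 1 = i0.+1%:Z by rewrite /=; lia.
have -> : k.+2%:Z + 1 = j0.+2%:Z by rewrite /=; lia.
rewrite (succ i0) -[i0.+2%:Z]/(j0.+1%:Z) (succ j0).
by case: (eta i0); case: (eta j0) => /=; field; rewrite pn qn.
Qed.

(** The coordinates of a chamber point are distinct, so at most one factor of the product changes
    and the increment is given exactly by the Leibniz rule. *)
Lemma duality_H_local s s' (y : int) x : weyl_chamber l x ->
  (forall z, 1 <= z <= l%:Z -> z != y -> duality_Q q s' z = duality_Q q s z) ->
  duality_H q s' x - duality_H q s x =
  \sum_k (\prod_(j | j != k) duality_Q q s (x j)) * duality_Q q s' (x k)
  - \sum_k (\prod_(j | j != k) duality_Q q s (x j)) * duality_Q q s (x k).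
Proof.
move=> xW ss'; have xin := xW.1; have xinj := weyl_chamber_inj xW.
rewrite -sumrB.
have [[k0 xk0]|H] := pselect (exists k, x k = y).
  rewrite (bigD1 k0)//= [\sum_(k < n | k != k0) _]big1 => [|k kk0]; last first.
    by rewrite ss' ?subrr// -xk0; apply: contra kk0 => /eqP /xinj ->.
  rewrite addr0 /duality_H (bigD1 k0)//= [\prod_(i < n) _](bigD1 k0)//=.
  rewrite (eq_bigr (fun j => duality_Q q s (x j))) => [|j jk0]; first by ring.
  by rewrite ss'// -xk0; apply: contra jk0 => /eqP /xinj ->.
have same k : duality_Q q s' (x k) = duality_Q q s (x k).
  by rewrite ss'//; apply/eqP => E; apply: H; exists k.
rewrite big1 => [|k _]; last by rewrite same subrr.
by rewrite /duality_H; under eq_bigr do rewrite same; rewrite subrr.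
Qed.

Lemma asep_generator_duality_H s x : 0 <= alpha -> 0 <= beta -> 0 <= gamma ->
    0 <= delta -> weyl_chamber l x ->
  L (fun s' => duality_H q s' x) s = Delta pp qq (duality_H_ext s) x.
Proof.
move=> alpha0 beta0 gamma0 delta0 xW; have xin := xW.1.
(* The linearization of H at [s]: all factors but one are frozen, so that L can be applied to each Q
   separately. Forbidden transitions have rate 0 and impose nothing in [local]. *)
pose g s' := \sum_k (\prod_(j | j != k) duality_Q q s (x j)) * duality_Q q s' (x k).
have local (r : R) (b : bool) s' y : (b -> forall z, 1 <= z <= l%:Z -> z != y ->
      duality_Q q s' z = duality_Q q s z) ->
    r * b%:R * (duality_H q s' x - duality_H q s x) = r * b%:R * (g s' - g s).
  case: b => [/(_ isT) H|_]; last by rewrite mulr0 !mul0r.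
  by rewrite (duality_H_local xW H).
have -> : L (fun s' => duality_H q s' x) s = L g s.
  case: s @g local => eta N g local; rewrite /asep_generator /=.
  congr (_ + _ + _).
  - apply: eq_bigr => i _; apply: eq_bigr => j /eqP ji; congr (_ + _).
    + apply: (local _ _ _ j.+1%:Z) => /andP[ei ej] z _ /negbTE zj.
      by rewrite (duality_Q_jump_right q_gt0)// zj mul1r.
    + apply: (local _ _ _ j.+1%:Z) => /andP[ei ej] z _ /negbTE zj.
      by rewrite (duality_Q_jump_left q_gt0)// zj mul1r.
  - apply: eq_bigr => i /eqP i0; congr (_ + _).
    + apply: (local _ _ _ 1) => ei z /andP[z1 _] /negbTE zj.
      by rewrite (duality_Q_left q_gt0)// ?zj ?mul1r//; exact: negbTE.
    + apply: (local _ _ _ 1) => ei z /andP[z1 _] /negbTE zj.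
      by rewrite (duality_Q_left q_gt0)// ?zj ?mul1r.
  - apply: eq_bigr => i /eqP il; congr (_ + _).
    + apply: (local _ _ _ l%:Z) => ei z /andP[_ zl] /negbTE zj.
      by rewrite (@duality_Q_right _ _ _ q_gt0 _ _ _ true)// ?zj ?mul1r//; exact: negbTE.
    + apply: (local _ _ _ l%:Z) => ei z /andP[_ zl] /negbTE zj.
      by rewrite (@duality_Q_right _ _ _ q_gt0 _ _ _ false)// ?zj ?mul1r.
rewrite /g (asep_generator_linear (ltW pp_gt0) (ltW hq))//.
apply: eq_bigr => k _; rewrite asep_generator_duality_Q//.
have rest e : duality_H_ext s (shift_coord x k e) =
    (\prod_(j | j != k) duality_Q q s (x j)) * duality_Q_ext s (x k + e).
  rewrite /duality_H_ext (bigD1 k)//= ffunE eqxx mulrC; congr (_ * _).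
  by apply: eq_bigr => j jk; rewrite ffunE (negbTE jk) duality_Q_ext_in.
have -> : duality_H_ext s x =
    (\prod_(j | j != k) duality_Q q s (x j)) * duality_Q_ext s (x k).
  rewrite /duality_H_ext (bigD1 k)//= mulrC; congr (_ * _).
  by apply: eq_bigr => j jk; rewrite duality_Q_ext_in.
by rewrite !rest; ring.
Qed.

(** In a collision the ratio r = Q_x / Q_(x+1) is 1 or q, and these are the two roots of p r^2 - (p
    + q) r + q = 0, with p and q the jump rates in this equation. The other two relations are built
    into [duality_Q_ext]. *)
Lemma duality_H_ext_relations s : boundary_relations (duality_H_ext s).
Proof.
have rest x k e : duality_H_ext s (shift_coord x k e) =
    duality_Q_ext s (x k + e) * \prod_(j | j != k) duality_Q_ext s (x j).
  rewrite /duality_H_ext (bigD1 k)//= ffunE eqxx; congr (_ * _).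
  by apply: eq_bigr => j jk; rewrite ffunE (negbTE jk).
have split1 x k : duality_H_ext s x =
    duality_Q_ext s (x k) * \prod_(j | j != k) duality_Q_ext s (x j).
  by rewrite /duality_H_ext (bigD1 k).
split.
- move=> x i j xW ji xji; have ij : i != j by rewrite -val_eqE /= ji; lia.
  rewrite !rest (split1 x j) xji addrK.
  rewrite (bigD1 i)//= [in X in _ + X](bigD1 j) 1?eq_sym//= xji.
  under [in X in _ + X]eq_bigl do rewrite andbC.
  have := xW.1 i; have := xW.1 j; rewrite xji => xj xi.
  rewrite !duality_Q_ext_in//.
  (* Since x_j = x_i + 1 <= l, the coordinate x_i is at most l - 1 and is an actual site. *)
  have [k xk] : exists k : 'I_l.-1, x i = k.+1%:Z.
    have kP : (`|x i|%N.-1 < l.-1)%N by lia.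
    by exists (Ordinal kP) => /=; lia.
  have E : duality_Q q s (x i) =
      (if s.1 k then q else 1) * duality_Q q s (x i + 1).
    have -> : x i + 1 = k.+2%:Z by rewrite xk; lia.
    rewrite xk; case: (s) => eta N; rewrite {1}/duality_Q height_succ expfzDr ?gt_eqF// mulrC.
    by case: (eta _); rewrite ?expr1z ?expr0z.
  have pn : pp != 0 by rewrite gt_eqF.
  by rewrite E; case: (s.1 _); field.
- move=> x i xW _ xi; rewrite rest (split1 x i) xi mulrA; congr (_ * _).
  rewrite subrr /duality_Q_ext ltr01 ltxx; case: ifP => //; lia.
- move=> x i xW _ xi; rewrite rest (split1 x i) xi mulrA; congr (_ * _).
  rewrite [in RHS]duality_Q_ext_in /duality_Q_ext; last by lia.
  by case: ifP; [lia|]; case: ifP => //; lia.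
Qed.

End duality.

(** * Identification of u with the expectation *)

Unset Implicit Arguments.
Set Strict Implicit.

Theorem proposition3p7 (R : realType) (l n : nat)
    (pp qq alpha beta gamma delta : R)
    (hl : (2 <= l)%N) (hn : (1 <= n)%N)
    (hq : 0 < qq) (hpq : qq < pp)
    (halpha : 0 <= alpha) (hbeta : 0 <= beta)
    (hgamma : 0 <= gamma) (hdelta : 0 <= delta)
    (hleft : alpha / pp + gamma / qq = 1)
    (hright : beta / pp + delta / qq = 1)
    (eta : config l) (N : nat)
    (d : measure_display) (Omega : measurableType d)
    (P : probability Omega R) (X : R -> Omega -> asep_state l)
    (hX : open_asep pp qq alpha beta gamma delta P X (eta, N%:Z))
    (u : R -> {ffun 'I_n -> int} -> R) :
  let q := qq / pp in
  let rho0 := alpha / pp in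
  let rhol := delta / qq in
  (forall (x : {ffun 'I_n -> int}) (t : R),
      in_box 1 l%:Z x -> 0 <= t ->
      has_derivative_Rplus (u ^~ x) t (Delta pp qq (u t) x)) ->
  (forall (x : {ffun 'I_n -> int}) (i j : 'I_n) (t : R),
      in_box 1 l%:Z x -> nat_of_ord j = i.+1 -> x j = x i + 1 -> 0 <= t ->
      pp * u t (shift_coord x j (-1)) + qq * u t (shift_coord x i 1)
      = (pp + qq) * u t x) ->
  (forall (x : {ffun 'I_n -> int}) (i : 'I_n) (t : R),
      weyl_chamber l x -> nat_of_ord i = 0%N -> x i = 1 -> 0 <= t ->
      u t (shift_coord x i (-1)) = (rho0 * q + 1 - rho0) * u t x) ->
  (forall (x : {ffun 'I_n -> int}) (i : 'I_n) (t : R),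
      weyl_chamber l x -> i.+1 = n -> x i = l%:Z -> 0 <= t ->
      u t (shift_coord x i 1) = (rhol / q + 1 - rhol) * u t x) ->
  (forall x : {ffun 'I_n -> int},
      weyl_chamber l x -> u 0 x = duality_H q (eta, N%:Z) x) ->
  forall (x : {ffun 'I_n -> int}) (t : R),
    weyl_chamber l x -> 0 <= t ->
    (u t x)%:E = 'E_P[fun w => duality_H q (X t w) x]%E.
Proof.
move=> q rho0 rhol ode collision left right u0 x t xW t0.
have pp0 : 0 < pp by exact: lt_trans hpq.
have [tp [htp hgen hmk]] := hX.
pose f k (s : asep_state l) := duality_H q s (@weyl_point n l k).
have q0 : 0 < q by rewrite divr_gt0.
have f0 k s : 0 <= f k s by apply: prodr_ge0 => i _; rewrite exprz_ge0// ltW.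
have good s : 0 <= s -> boundary_relations l pp qq alpha delta (u s).
  by move=> s0; split=> [y i j yW ji yji|y i yW i0 yi|y i yW il yi];
    [apply: collision => //; exact: yW.1|exact: left|exact: right].
(* The rows given by [Delta_representable] are assembled into one matrix, valid for [u s] and for
   the extended H alike. *)
have /choice[A HA] : forall k : weyl_index n l, exists c : weyl_index n l -> R,
    forall g, boundary_relations l pp qq alpha delta g ->
    Delta pp qq g (weyl_point k) = \sum_j c j * g (weyl_point j).
  by move=> k; exact/Delta_representable/weyl_pointP.
have [k xk] := weyl_point_surj xW.
rewrite (@expectation_discrete _ _ _ P _
  (@pickle ({ffun 'I_l.-1 -> bool} * int)%type) (pcan_inj pickleK) (X t)
  (duality_H q ^~ x)) => [|y|y]; last 2 first.
- by case: hmk => mX _ _; exact: mX.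
- by rewrite -xk; exact: f0.
have := @transition_esum_ode R _ _ tp
  (asep_generator pp qq alpha beta gamma delta)
  (asep_rate_bound l pp qq alpha beta gamma delta) A f
  (fun s j => u s (weyl_point j)) (eta, N%:Z) htp hgen.
move=> /(_ (asep_generator_positive (ltW pp0) (ltW hq) halpha hbeta hgamma hdelta)).
move=> /(_ (@asep_generator_const _ _ _ _ _ _ _ _) f0).
have generator_f i y : asep_generator pp qq alpha beta gamma delta (f i) y =
    matrix_act A (f ^~ y) i.
  rewrite (asep_generator_duality_H hl hq hpq hleft hright)//; last exact: weyl_pointP.
  rewrite HA; last exact: duality_H_ext_relations.
  apply: eq_bigr => j _; rewrite duality_H_ext_in//.
  exact: (weyl_pointP j).1.
move=> /(_ generator_f).
have ode' s i : 0 <= s -> has_derivative_Rplus (fun r => u r (weyl_point i)) s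
    (matrix_act A (fun j => u s (weyl_point j)) i).
  move=> s0; rewrite /matrix_act -HA; last exact: good.
  by apply: ode => //; exact: (weyl_pointP i).1.
move=> /(_ ode') /(_ (fun i => u0 _ (weyl_pointP i))) /(_ t k t0).
(* It remains to match the weights: the law of [X t] is the row of [tp t] at the initial state. *)
rewrite xk => <-; apply: eq_esum => y _.
by rewrite (markov_process_law y hmk t0) -EFinM /f xk.
Qed.
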